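(* Let $G$ be a locally compact, second countable group, regarded as a metric space with respect to a plig metric $d$ on $G$. Then $(G,d)$ has a uniform embedding into the separable, strictly convex Banach space $$\bigoplus_{n=1}^\infty L^{2n}(G,\mu)\quad\text{(in the } \ell^2 \text{ sense)}.$$
   Context: Topological groups are assumed Hausdorff. A plig metric on a topological group $G$ is a metric $d$ on $G$ which is: proper (all closed $d$-bounded subsets of $G$ are compact), left invariant ($d(gx,gy)=d(x,y)$ for all $g,x,y\in G$), and generates the given topology of $G$. Every locally compact, second countable group has a plig metric, and for any two plig metrics on such a group the identity map is a coarse equivalence, so the existence of a uniform embedding does not depend on the choice of $d$. $\mu$ is a left Haar measure on $G$, and the $L^{2n}(G,\mu)$ are the spaces of real-valued functions. The direct sum in the $\ell^2$ sense consists of sequences $\xi=(\xi_n)_{n\ge1}$ with $\xi_n\in L^{2n}(G,\mu)$ and norm $\|\xi\|=\left(\sum_{n=1}^\infty\|\xi_n\|_{2n}^2\right)^{1/2}<\infty$. A normed space is strictly convex if $\|\tfrac12(x+y)\|<1$ for all $x\ne y$ with $\|x\|=\|y\|=1$. A map $f:X\to Y$ between metric spaces $(X,d_X)$, $(Y,d_Y)$ is a uniform embedding if there exist non-decreasing functions $\rho_-,\rho_+:[0,\infty)\to[0,\infty)$ with $\lim_{t\to\infty}\rho_-(t)=\lim_{t\to\infty}\rho_+(t)=\infty$ and $$\rho_-(d_X(x,y))\le d_Y(f(x),f(y))\le\rho_+(d_X(x,y))\quad\text{for all }x,y\in X.$$ *)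

(* Defs.v *)
From HB Require Import structures.
From mathcomp Require Import all_boot all_order all_algebra.
From mathcomp Require Import all_classical all_reals all_analysis.
(* [measurable_realfun] provides the ring structure of [{mfun T >-> R}]; neither
   file is exported by [all_analysis]. *)
From mathcomp Require Import measurable_realfun ess_sup_inf.
From mathcomp Require Import ring lra.

Set Implicit Arguments.
Unset Strict Implicit.
Unset Printing Implicit Defensive.
Import Order.TTheory GRing.Theory Num.Theory.
Import numFieldNormedType.Exports.
Local Open Scope classical_set_scope.
Local Open Scope ring_scope.

HB.mixin Record isTopologicalGroup G & Topological G & Group G := {
  mulg_continuous : continuous (fun x : G * G => (x.1 * x.2)%g) ;
  invg_continuous : continuous (fun x : G => (x^-1)%g)
}.

(* The base point is arbitrary; it is there only because measurable types are
   pointed in MathComp-Analysis, and a group always has one. *)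
#[short(type="topologicalGroupType")]
HB.structure Definition TopologicalGroup :=
  {G of PointedTopological G & Group G & isTopologicalGroup G}.

Notation borelType G := (g_sigma_algebraType (@open G)).

Section haar.
Context (R : realType) (G : topologicalGroupType).
Implicit Type mu : {measure set (borelType G) -> \bar R}.

(* Compact sets are automatically Borel when [G] is Hausdorff. *)
Definition radon mu :=
  [/\ forall K : set G, compact K -> measurable (K : set (borelType G)) ->
        (mu K < +oo)%E,
      forall A : set (borelType G), measurable A ->
        mu A = ereal_inf [set mu U | U in [set U : set G | open U /\ A `<=` U]]
    & forall U : set G, open U ->
        mu U = ereal_sup [set mu K | K in
          [set K : set G | [/\ compact K, measurable (K : set (borelType G))
                             & K `<=` U]]] ].

Definition left_haar_measure mu :=
  [/\ radon mu, mu [set: G] != 0%E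
    & forall (g : G) (A : set (borelType G)), measurable A ->
        mu [set (g * x)%g | x in (A : set G)] = mu A].

End haar.

Section metrics.
Context (R : realType).

Definition is_metric (X : Type) (d : X -> X -> R) :=
  [/\ forall x y, 0 <= d x y,
      forall x y, d x y = 0 <-> x = y,
      forall x y, d x y = d y x
    & forall x y z, d x z <= d x y + d y z].

Definition metric_bounded (X : Type) (d : X -> X -> R) (A : set X) :=
  exists M, forall x y, A x -> A y -> d x y <= M.

Definition metric_generates (X : topologicalType) (d : X -> X -> R) :=
  forall (x : X) (A : set X),
    nbhs x A <-> exists2 e, 0 < e & [set y | d x y < e] `<=` A.

Definition plig_metric (G : topologicalGroupType) (d : G -> G -> R) :=
  [/\ is_metric d,
      forall A : set G, closed A -> metric_bounded d A -> compact A,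
      forall g x y : G, d (g * x)%g (g * y)%g = d x y
    & metric_generates d].

(* Nondecreasing [0, oo) -> [0, oo) tending to oo; the values of [rho] at
   negative arguments are irrelevant. *)
Definition control_function (rho : R -> R) :=
  [/\ forall t, 0 <= t -> 0 <= rho t,
      forall s t, 0 <= s -> s <= t -> rho s <= rho t
    & rho t @[t --> +oo] --> +oo].

Definition uniform_embedding (X Y : Type) (dX : X -> X -> R) (dY : Y -> Y -> R)
    (f : X -> Y) :=
  exists rho_ rho' : R -> R,
    [/\ control_function rho_, control_function rho'
      & forall x y, rho_ (dX x y) <= dY (f x) (f y) <= rho' (dX x y)].

End metrics.

Section normed_spaces.
Context (R : realType) (V : normedModType R).

Definition norm_dist (x y : V) : R := `|x - y|.

Definition banach := forall F : set_system V, ProperFilter F -> cauchy F -> cvg F.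

Definition separable_space := exists2 D : set V, countable D & dense D.

Definition strictly_convex :=
  forall x y : V, `|x| = 1 -> `|y| = 1 -> x != y -> `|2^-1 *: (x + y)| < 1.

End normed_spaces.
Arguments banach {R} V.
Arguments separable_space {R} V.
Arguments strictly_convex {R} V.

Section aeEqMfun_lmodule.
Context d (T : measurableType d) (R : realType).
Variable mu : {measure set T -> \bar R}.
Local Open Scope quotient_scope.

Local Notation M := {mfun T >-> R}.
Local Notation V := {mfun_ mu, T >-> measurableTypeR R}.
Implicit Types (f g h : M) (u v w : V) (a b : R).

(* [R] and [measurableTypeR R] carry the same measurable sets under different
   displays. *)
Definition ae_pi f : V :=
  \pi_V (mfun_Sub (mem_set (@measurable_funPT _ _ _ _ f)
           : (f : T -> measurableTypeR R) \in mfun)).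

Definition ae_repr u : M :=
  mfun_Sub (mem_set (@measurable_funPT _ _ _ _ (repr u))
    : (repr u : T -> R) \in mfun).

Lemma ae_reprK u : ae_pi (ae_repr u) = u.
Proof.
rewrite -[RHS]reprK; congr (\pi_V _); exact: val_inj.
Qed.

Lemma ae_piP f g : ae_pi f = ae_pi g <-> (f : T -> R) = g %[ae mu].
Proof.
split; first by move=> /eqmodP/asboolP.
by move=> fg; apply/eqmodP/asboolP.
Qed.

Lemma ae_repr_pi f : (ae_repr (ae_pi f) : T -> R) = f %[ae mu].
Proof. by apply/ae_piP; rewrite ae_reprK. Qed.

Definition ae_zero : V := ae_pi 0.
Definition ae_opp u : V := ae_pi (- ae_repr u).
Definition ae_add u v : V := ae_pi (ae_repr u + ae_repr v).
Definition ae_scale a u : V := ae_pi (a *: ae_repr u).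

Lemma ae_piD f g : ae_pi (f + g) = ae_add (ae_pi f) (ae_pi g).
Proof.
apply/ae_piP; move: (ae_repr_pi f) (ae_repr_pi g).
apply: filterS2 => x fx gx _.
by rewrite -[RHS]/(ae_repr (ae_pi f) x + ae_repr (ae_pi g) x) fx// gx.
Qed.

Lemma ae_piN f : ae_pi (- f) = ae_opp (ae_pi f).
Proof.
apply/ae_piP; move: (ae_repr_pi f).
by apply: filterS => x fx _; rewrite -[RHS]/(- ae_repr (ae_pi f) x) fx.
Qed.

Lemma ae_piZ a f : ae_pi (a *: f) = ae_scale a (ae_pi f).
Proof.
apply/ae_piP; move: (ae_repr_pi f).
by apply: filterS => x fx _; rewrite -[RHS]/(a * ae_repr (ae_pi f) x) fx.
Qed.

Let addA : associative ae_add.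
Proof.
move=> u v w; rewrite -(ae_reprK u) -(ae_reprK v) -(ae_reprK w).
by rewrite -!ae_piD addrA.
Qed.

Let addC : commutative ae_add.
Proof. by move=> u v; rewrite /ae_add addrC. Qed.

Let add0 : left_id ae_zero ae_add.
Proof. by move=> u; rewrite -(ae_reprK u) -ae_piD add0r. Qed.

Let addN : left_inverse ae_zero ae_opp ae_add.
Proof. by move=> u; rewrite -(ae_reprK u) -ae_piN -ae_piD addNr. Qed.

HB.instance Definition _ := GRing.isZmodule.Build V addA addC add0 addN.

Let scaleA a b u : ae_scale a (ae_scale b u) = ae_scale (a * b) u.
Proof. by rewrite -(ae_reprK u) -!ae_piZ scalerA. Qed.

Let scale1 : left_id 1 ae_scale.
Proof. by move=> u; rewrite -(ae_reprK u) -!ae_piZ scale1r. Qed.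

Let scaleDr : right_distributive ae_scale +%R.
Proof.
move=> a u v; rewrite -(ae_reprK u) -(ae_reprK v).
by rewrite -[_ + _]ae_piD -!ae_piZ -[RHS]ae_piD scalerDr.
Qed.

Let scaleDl u : {morph ae_scale^~ u : a b / a + b}.
Proof.
by move=> a b; rewrite -(ae_reprK u) -!ae_piZ -[RHS]ae_piD scalerDl.
Qed.

HB.instance Definition _ :=
  GRing.Zmodule_isLmodule.Build R V scaleA scale1 scaleDr scaleDl.

End aeEqMfun_lmodule.

Lemma eq_ae_Lnorm d (T : measurableType d) (R : realType)
    (mu : {measure set T -> \bar R}) (p : \bar R) (f g : {mfun T >-> R}) :
  (1 <= p)%E -> (f : T -> R) = g %[ae mu] ->
  'N[mu]_p[EFin \o f]%E = 'N[mu]_p[EFin \o g]%E.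
Proof.
move=> + fg; rewrite unlock; case: p => [r _|_|//].
  apply: (congr1 (fun z => poweR z _)).
  apply: ge0_ae_eq_integral.
  - exact: measurableT.
  - apply: (measurableT_comp (measurable_poweR _)).
    by apply: measurableT_comp => //; exact/measurable_EFinP.
  - apply: (measurableT_comp (measurable_poweR _)).
    by apply: measurableT_comp => //; exact/measurable_EFinP.
  - by move=> x _; exact: poweR_ge0.
  - by move=> x _; exact: poweR_ge0.
  - by apply: filterS fg => x fg xT /=; rewrite fg.
case: ifPn => [_|//]; apply: eq_ess_sup.
by apply: filterS fg => x fg /=; rewrite fg.
Qed.

Section Lspace_lmodule.
Context d (T : measurableType d) (R : realType).
Variables (mu : {measure set T -> \bar R}) (p : \bar R) (p1 : (1 <= p)%E).
Local Notation V := {mfun_ mu, T >-> measurableTypeR R}.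
Local Notation M := {mfun T >-> R}.
Implicit Types (f g : M) (u v : V).

Definition finLspace : {pred V} := mem [set u : V | finite_norm mu p u].

Section Sub.
Context (u : V) (uP : u \in finLspace).
Definition Lspace_Sub_subproof :=
  @isFinLebesgue.Build d T R mu p p1 u (set_mem uP).
#[local] HB.instance Definition _ := Lspace_Sub_subproof.
Definition Lspace_Sub : LspaceType mu p1 := [the LspaceType mu p1 of u].
End Sub.

Lemma Lspace_rect (K : LspaceType mu p1 -> Type) :
  (forall u (uP : u \in finLspace), K (Lspace_Sub uP)) -> forall x, K x.
Proof.
move=> Ksub [u [[Pu]]].
have uP : u \in finLspace by rewrite inE.
have -> : Pu = set_mem uP by [].
exact: Ksub.
Qed.

Lemma Lspace_valP u (uP : u \in finLspace) : Lspace_Sub uP = u :> V.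
Proof. by []. Qed.

HB.instance Definition _ :=
  isSub.Build _ _ (LspaceType mu p1) Lspace_rect Lspace_valP.
HB.instance Definition _ := [Choice of LspaceType mu p1 by <:].

Lemma Lnorm_ae_pi f :
  'N[mu]_p[EFin \o ae_repr (ae_pi mu f)]%E = 'N[mu]_p[EFin \o f]%E.
Proof. by apply: (eq_ae_Lnorm p1); exact: ae_repr_pi. Qed.

Lemma finite_norm_ae_pi f : finite_norm mu p f -> ae_pi mu f \in finLspace.
Proof. by move=> fp; rewrite inE /= /finite_norm [ltLHS]Lnorm_ae_pi. Qed.

Lemma ae_repr_Lfun u : u \in finLspace -> (ae_repr u : T -> R) \in Lfun mu p.
Proof.
by rewrite inE => up; apply/andP; split; [exact: mfunP|rewrite inE].
Qed.

Lemma finLspace_submod_closed : submod_closed finLspace.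
Proof.
split; first exact/finite_norm_ae_pi/finite_norm_cst0.
move=> a u v uP vP.
have -> : a *: u + v = ae_pi mu (a *: ae_repr u + ae_repr v).
  by rewrite ae_piD ae_piZ !ae_reprK.
apply: finite_norm_ae_pi.
have [_ /(_ a _ _ (ae_repr_Lfun uP) (ae_repr_Lfun vP))] :=
  @Lfun_submod_closed _ T R mu p p1.
by move=> /andP[_]; rewrite inE.
Qed.

HB.instance Definition _ :=
  GRing.isSubmodClosed.Build R V finLspace finLspace_submod_closed.
HB.instance Definition _ :=
  [SubChoice_isSubLmodule of LspaceType mu p1 by <:].

End Lspace_lmodule.

Section Lspace_normed.
Context d (T : measurableType d) (R : realType).
Variables (mu : {measure set T -> \bar R}) (p : \bar R) (p1 : (1 <= p)%E).
Local Notation E := (LspaceType mu p1).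
Implicit Types x y : E.

(* [x] coerces to one of its representatives, on whose choice the norm does not
   depend, by [eq_ae_Lnorm]. *)
Definition Lspace_norm x : R := fine 'N[mu]_p[EFin \o (x : T -> R)]%E.

Definition Lspace_Lfun x : LfunType mu p1 := Lfun_Sub p1 (ae_repr_Lfun (valP x)).

Lemma Lspace_normE x : (Lspace_norm x)%:E = 'N[mu]_p[EFin \o Lspace_Lfun x]%E.
Proof. exact: (finite_norm_fine (Lspace_Lfun x)). Qed.

Let normD x y : Lspace_norm (x + y) <= Lspace_norm x + Lspace_norm y.
Proof.
apply: le_trans (ler_LnormD (Lspace_Lfun x) (Lspace_Lfun y)).
by rewrite /Lspace_norm [X in fine X](@Lnorm_ae_pi _ T R mu p p1
  (ae_repr (val x) + ae_repr (val y))).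
Qed.

Let normZ a x : Lspace_norm (a *: x) = `|a| * Lspace_norm x.
Proof.
apply: EFin_inj; rewrite EFinM !Lspace_normE -LnormZ.
exact: (@Lnorm_ae_pi _ T R mu p p1 (a *: ae_repr (val x))).
Qed.

Let norm0 x : Lspace_norm x = 0 -> x = 0.
Proof.
move=> /(@fine_Lnormr_eq0 _ T R mu p p1 (Lspace_Lfun x)) x0.
by apply: val_inj; rewrite -[LHS]ae_reprK; exact/ae_piP.
Qed.

HB.instance Definition _ :=
  Lmodule_isNormed.Build R E normD normZ norm0.

End Lspace_normed.

Section l2sum.
Context (R : realType) (E : nat -> normedModType R).

Definition seq_prod : Type := forall n, E n.
Implicit Types (x y z : seq_prod) (a b : R).

HB.instance Definition _ := gen_eqMixin seq_prod.
HB.instance Definition _ := gen_choiceMixin seq_prod.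

Let sp_zero : seq_prod := fun=> 0.
Let sp_opp x : seq_prod := fun n => - x n.
Let sp_add x y : seq_prod := fun n => x n + y n.
Let sp_scale a x : seq_prod := fun n => a *: x n.

Let addA : associative sp_add.
Proof. by move=> x y z; apply: functional_extensionality_dep => n; exact: addrA. Qed.

Let addC : commutative sp_add.
Proof. by move=> x y; apply: functional_extensionality_dep => n; exact: addrC. Qed.

Let add0 : left_id sp_zero sp_add.
Proof. by move=> x; apply: functional_extensionality_dep => n; exact: add0r. Qed.

Let addN : left_inverse sp_zero sp_opp sp_add.
Proof. by move=> x; apply: functional_extensionality_dep => n; exact: addNr. Qed.

HB.instance Definition _ := GRing.isZmodule.Build seq_prod addA addC add0 addN.

Let scaleA a b x : sp_scale a (sp_scale b x) = sp_scale (a * b) x.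
Proof. by apply: functional_extensionality_dep => n; exact: scalerA. Qed.

Let scale1 : left_id 1 sp_scale.
Proof. by move=> x; apply: functional_extensionality_dep => n; exact: scale1r. Qed.

Let scaleDr : right_distributive sp_scale +%R.
Proof.
by move=> a x y; apply: functional_extensionality_dep => n; exact: scalerDr.
Qed.

Let scaleDl x : {morph sp_scale^~ x : a b / a + b}.
Proof. by move=> a b; apply: functional_extensionality_dep => n; exact: scalerDl. Qed.

HB.instance Definition _ :=
  GRing.Zmodule_isLmodule.Build R seq_prod scaleA scale1 scaleDr scaleDl.

Definition l2_sqsum x : \bar R := (\sum_(0 <= n <oo) (`|x n| ^+ 2)%:E)%E.

Definition square_summable : {pred seq_prod} :=
  mem [set x | (l2_sqsum x < +oo)%E].

Lemma square_summableP x : reflect (l2_sqsum x < +oo)%E (x \in square_summable).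
Proof. by apply: (iffP idP); rewrite inE. Qed.

Lemma l2_sqsum_ge0 x : (0 <= l2_sqsum x)%E.
Proof. by apply: nneseries_ge0 => n _ _; rewrite lee_fin sqr_ge0. Qed.

Lemma l2_sqsumZ a x : l2_sqsum (a *: x) = ((a ^+ 2)%:E * l2_sqsum x)%E.
Proof.
rewrite /l2_sqsum -nneseriesZl; last by move=> n _; rewrite lee_fin sqr_ge0.
apply: eq_eseriesr => n _.
by rewrite -EFinM -[a ^+ 2]real_normK ?num_real// -exprMn -normrZ.
Qed.

(* Minkowski's inequality, through
   (u + v)^2 <= (1 + t / s) u^2 + (1 + s / t) v^2. *)
Lemma l2_sqsumD x y (s t : R) : 0 < s -> 0 < t ->
  (l2_sqsum x <= (s ^+ 2)%:E)%E -> (l2_sqsum y <= (t ^+ 2)%:E)%E ->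
  (l2_sqsum (x + y)%R <= ((s + t) ^+ 2)%:E)%E.
Proof.
move=> s0 t0 xs yt.
have st : 0 <= 1 + t / s by rewrite addr_ge0// divr_ge0// ltW.
have ts : 0 <= 1 + s / t by rewrite addr_ge0// divr_ge0// ltW.
apply: (@le_trans _ _
  ((1 + t / s)%:E * l2_sqsum x + (1 + s / t)%:E * l2_sqsum y)%E).
  rewrite /l2_sqsum -!nneseriesZl; try by move=> n _; rewrite lee_fin sqr_ge0.
  rewrite -nneseriesD; try by
    move=> n _ _; rewrite -EFinM lee_fin mulr_ge0// sqr_ge0.
  apply: lee_nneseries => [n _ _|n _]; first by rewrite lee_fin sqr_ge0.
  rewrite -!EFinM -EFinD lee_fin.
  have xyn : `|(x + y) n| ^+ 2 <= (`|x n| + `|y n|) ^+ 2.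
    by rewrite lerXn2r ?nnegrE ?addr_ge0//; exact: ler_normD.
  apply: (le_trans xyn); rewrite -subr_ge0.
  set u := `|x n|; set v := `|y n|.
  have -> : (1 + t / s) * u ^+ 2 + (1 + s / t) * v ^+ 2 - (u + v) ^+ 2 =
      (t * u - s * v) ^+ 2 / (s * t).
    by field; rewrite !gt_eqF.
  by rewrite divr_ge0 ?sqr_ge0// mulr_ge0// ltW.
have -> : (s + t) ^+ 2 = (1 + t / s) * s ^+ 2 + (1 + s / t) * t ^+ 2.
  by field; rewrite !gt_eqF.
by rewrite [leRHS]EFinD leeD// EFinM lee_wpmul2l// lee_fin.
Qed.

Lemma l2_sqsum_bound x : (l2_sqsum x < +oo)%E ->
  exists2 s, 0 < s & (l2_sqsum x <= (s ^+ 2)%:E)%E.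
Proof.
move=> xoo; have xfin : l2_sqsum x \is a fin_num.
  by rewrite ge0_fin_numE// l2_sqsum_ge0.
have x0 : 0 <= fine (l2_sqsum x) by rewrite fine_ge0// l2_sqsum_ge0.
exists (1 + fine (l2_sqsum x)); first by rewrite ltr_pwDl.
rewrite -[leLHS]fineK// lee_fin; nra.
Qed.

Lemma square_summable_submod_closed : submod_closed square_summable.
Proof.
split.
  apply/square_summableP; rewrite /l2_sqsum eseries0// => n _ _.
  by rewrite normr0 expr0n.
move=> a x y /square_summableP xoo /square_summableP yoo.
have axoo : (l2_sqsum (a *: x) < +oo)%E.
  by rewrite l2_sqsumZ lte_mul_pinfty ?lee_fin ?sqr_ge0.
have [s s0 xs] := l2_sqsum_bound axoo; have [t t0 yt] := l2_sqsum_bound yoo.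
by apply/square_summableP; apply: le_lt_trans (l2_sqsumD s0 t0 xs yt) (ltry _).
Qed.

HB.instance Definition _ :=
  GRing.isSubmodClosed.Build R seq_prod square_summable
    square_summable_submod_closed.

Definition l2sum : Type := {x : seq_prod | x \in square_summable}.
HB.instance Definition _ := [isSub of l2sum for @sval _ _].
HB.instance Definition _ := [Choice of l2sum by <:].
HB.instance Definition _ := [SubChoice_isSubLmodule of l2sum by <:].

Definition l2norm (x : l2sum) : R := Num.sqrt (fine (l2_sqsum (val x))).

Lemma l2sum_sqsum_fin (x : l2sum) : l2_sqsum (val x) \is a fin_num.
Proof.
by rewrite ge0_fin_numE ?l2_sqsum_ge0//; exact/square_summableP/(valP x).
Qed.

Let normD (x y : l2sum) : l2norm (x + y) <= l2norm x + l2norm y.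
Proof.
have bound (z : l2sum) (e : R) : 0 < e ->
    (l2_sqsum (val z) <= ((l2norm z + e) ^+ 2)%:E)%E.
  move=> e0; rewrite -[leLHS]fineK ?l2sum_sqsum_fin// lee_fin.
  rewrite -[leLHS]sqr_sqrtr ?fine_ge0 ?l2_sqsum_ge0// -/(l2norm z).
  by rewrite lerXn2r ?nnegrE ?addr_ge0 ?sqrtr_ge0 ?lerDl// ltW.
apply/ler_addgt0Pr => e e0; have e20 : 0 < e / 2 by rewrite divr_gt0.
have pos (z : l2sum) : 0 < l2norm z + e / 2 by rewrite ltr_wpDl ?sqrtr_ge0.
have := l2_sqsumD (pos x) (pos y) (bound x _ e20) (bound y _ e20).
rewrite -[leLHS](@fineK _ (l2_sqsum (val (x + y)))) ?l2sum_sqsum_fin// lee_fin.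
have -> : l2norm x + e / 2 + (l2norm y + e / 2) = l2norm x + l2norm y + e.
  by field.
move=> xy; rewrite -[leRHS]ger0_norm -?sqrtr_sqr ?ler_wsqrtr//.
by rewrite !addr_ge0 ?sqrtr_ge0// ltW.
Qed.

Let normZ a (x : l2sum) : l2norm (a *: x) = `|a| * l2norm x.
Proof.
rewrite /l2norm [val (a *: x)]linearZ/= l2_sqsumZ fineM ?l2sum_sqsum_fin//=.
by rewrite sqrtrM ?sqr_ge0// sqrtr_sqr.
Qed.

Let norm0 (x : l2sum) : l2norm x = 0 -> x = 0.
Proof.
move=> /eqP; rewrite sqrtr_eq0 => x0; apply: val_inj.
apply: functional_extensionality_dep => n.
have {}x0 : l2_sqsum (val x) = 0%E.
  apply/eqP; rewrite eq_le l2_sqsum_ge0 andbT.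
  by rewrite -[leLHS]fineK ?l2sum_sqsum_fin.
apply/eqP; rewrite -normr_eq0 -sqrf_eq0 eq_le sqr_ge0 andbT.
suff : ((`|val x n| ^+ 2)%:E <= l2_sqsum (val x))%E by rewrite x0 lee_fin.
rewrite /l2_sqsum (@nneseriesD1 _ _ n)//.
by apply: leeDl; apply: nneseries_ge0 => k _ _; rewrite lee_fin sqr_ge0.
Qed.

HB.instance Definition _ :=
  Lmodule_isNormed.Build R l2sum normD normZ norm0.

End l2sum.

Lemma exponent_ge1 (R : realType) (n : nat) : (1 <= (2 * n.+1)%:R%:E :> \bar R)%E.
Proof. by rewrite lee_fin ler1n mulnS. Qed.

(* The summand of index [n] is L^(2(n+1)): indices start at 0 instead of 1. *)
Definition sum_L2n (R : realType) d (T : measurableType d)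
    (mu : {measure set T -> \bar R}) : normedModType R :=
  l2sum (fun n : nat =>
    @LspaceType d T R mu (2 * n.+1)%:R%:E (exponent_ge1 R n)).

(* Main.v *)
Require Import Defs.
From HB Require Import structures.
From mathcomp Require Import all_boot all_order all_algebra.
From mathcomp Require Import all_classical all_reals all_analysis.
From mathcomp Require Import measurable_realfun.
From mathcomp Require Import ring lra.

Set Implicit Arguments.
Unset Strict Implicit.
Unset Printing Implicit Defensive.
Import Order.TTheory GRing.Theory Num.Theory.
Import numFieldNormedType.Exports.
Local Open Scope classical_set_scope.
Local Open Scope ring_scope.

(** The four assertions are independent.

    Completeness. A normed space is complete as soon as the sequences with steps
    of norm at most [4^-1 ^+ k] converge. In a Lebesgue space such a sequence
    converges almost everywhere, and Fatou's lemma turns this into convergence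
    in norm (Riesz-Fischer, [Lspace_complete]). In a sum in the l2 sense it
    converges coordinatewise, and bounds on partial sums pass to the limit
    ([l2sum_complete]).

    Separability. It suffices to find a countable family whose rational
    combinations are dense. In a Lebesgue space the indicators of measurable
    sets of finite measure span a dense subspace; by outer regularity these sets
    are approximated by finite unions of members of a countable basis
    ([basic_union_dense], [Lspace_countably_spanned]).

    Strict convexity. Even exponents satisfy Clarkson's inequality for an
    algebraic reason, and the resulting strict inequality between the square of
    the norm of a midpoint and the mean of the squares is summed over the
    coordinates ([Lspace_strict_midpoint], [l2sum_strictly_convex]).

    Embedding. Let a point [x] act through its tent of radius [r], the function
    [z |-> max(0, 1 - d(x, z) / r)]. In the space of exponent [p], the tents at
    [x] and [y] are at distance at most [d(x, y) / r] times the p-th root of the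
    volume of two balls of radius [r], and, when [d(x, y) >= 2 r], at least
    half the p-th root of the volume of a fixed ball; by left invariance these
    volumes do not depend on [x] and [y]. The p-th root of a positive constant
    tends to 1 as [p] grows. Hence, whatever the growth of the volume of balls, some
    large exponent makes the tents of a given radius [2 / r]-Lipschitz in [x]
    and at mutual distance at least 1/4 for far away points
    ([tent_class_lip], [tent_class_far]). Let the radii be proportional to
    [k + 1] and host the tents of the k-th radius in a summand whose exponent is
    good for it, leaving the other summands zero. As the inverse squares of the
    radii are summable, the resulting map is Lipschitz; and the square of the
    distance of the images of [x] and [y] is at least 1/16 times the number of
    radii at most [d(x, y) / 2], which tends to infinity with [d(x, y)]. *)

(** * Complete and separable normed spaces *)

Section completeness_criterion.
Context (R : realType) (V : normedModType R).
Implicit Type u : nat -> V.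

Definition geometric_steps (q : R) u := forall n, `|u n.+1 - u n| <= q ^+ n.

(** Testing completeness on such fast sequences only is what makes the
    Riesz-Fischer argument below short: the ratio [4^-1] leaves room to lose a
    factor [2 ^+ k] when passing from norms to pointwise values. *)
Definition geometric_complete := forall u, geometric_steps 4^-1 u -> cvgn u.

Lemma geometric_steps_dist q u m n : 0 <= q <= 2^-1 ->
  geometric_steps q u -> (m <= n)%N -> `|u n - u m| <= 2 * q ^+ m.
Proof.
move=> /andP[q0 q2] gu /subnKC <-; move: (n - m)%N => k.
suff : `|u (m + k)%N - u m| <= 2 * q ^+ m - 2 * q ^+ (m + k).
  by move/le_trans; apply; rewrite gerBl mulr_ge0// exprn_ge0.
elim: k => [|k IH]; first by rewrite addn0 !subrr normr0.
rewrite addnS -(subrKA (u (m + k)%N)) (le_trans (ler_normD _ _))//.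
have := gu (m + k)%N; rewrite exprS.
have : q * q ^+ (m + k) <= 2^-1 * q ^+ (m + k) by rewrite ler_wpM2r// exprn_ge0.
lra.
Qed.

(** A Cauchy filter contains balls of radius [4^-1 * 4^-1 ^+ n]; their centres
    form a sequence with geometric steps, because consecutive balls meet, and
    the filter converges to the limit of the centres. *)
Lemma geometric_complete_banach : geometric_complete -> banach V.
Proof.
move=> cV F FF cF; have Fex := (cauchyP F).1 cF.
pose r n : R := 4^-1 * 4^-1 ^+ n.
have r0 n : 0 < r n by rewrite mulr_gt0// exprn_gt0.
have /choice[u Fu] : forall n, exists x, F (ball x (r n)).
  by move=> n; exact: Fex.
have gu : geometric_steps 4^-1 u.
  move=> n; have [z [z1 z2]] := filter_ex (filterI (Fu n) (Fu n.+1)).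
  move: z1 z2; rewrite -!ball_normE/= => z1 z2.
  rewrite -(subrKA z) (le_trans (ler_normD _ _))//.
  rewrite (distrC z).
  apply: (le_trans (lerD (ltW z2) (ltW z1))).
  rewrite /r exprS.
  have : 0 <= 4^-1 ^+ n :> R by rewrite exprn_ge0.
  lra.
have [l ul] := (cvg_ex _).1 (cV _ gu).
apply/cvg_ex; exists l; apply/fcvg_ballP => e e0.
have e2 : 0 < e / 2 by rewrite divr_gt0.
have rc : (r n @[n --> \oo] --> (0 : R)).
  by rewrite -(mulr0 4^-1); apply: cvgMl_tmp; apply: cvg_expr;
    rewrite ger0_norm// invf_lt1// ltr1n.
have [N _ /(_ _ (leqnn N)) /= [ulN rN]] :
   \forall n \near \oo, ball l (e / 2) (u n) /\ `|r n - 0| < e / 2.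
  apply: filterI; first exact: (cvg_ball ul e2).
  by move/cvgr_distC_lt : rc => /(_ _ e2).
apply: filterS (Fu N) => y; move: ulN; rewrite -!ball_normE/= => lu uy.
rewrite -(subrKA (u N)) (le_lt_trans (ler_normD _ _))//.
move: rN; rewrite subr0 gtr0_norm// => rN; lra.
Qed.

End completeness_criterion.
Arguments geometric_complete {R} V.

Lemma geometric_steps_cvg (R : realType) (u : nat -> R) :
  geometric_steps 2^-1 u -> cvgn u.
Proof.
move=> gu; apply: cauchy_cvg; apply: cauchy_exP => e e0.
have rc : (2 * 2^-1 ^+ n @[n --> \oo] --> (0 : R)).
  rewrite -(mulr0 2); apply: cvgMl_tmp; apply: cvg_expr.
  by rewrite ger0_norm// invf_lt1// ltr1n.
move/cvgr_distC_lt : rc => /(_ _ e0) [N _ /(_ _ (leqnn N)) /=].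
rewrite subr0 ger0_norm ?mulr_ge0 ?exprn_ge0 ?invr_ge0// => Ne.
exists (u N); exists N => // k /= Nk; rewrite -ball_normE/= distrC.
by apply: le_lt_trans Ne; apply: geometric_steps_dist => //; lra.
Qed.

Section rational_span.
Context (R : realType) (V : normedModType R) (I : countType) (c : I -> V).
Implicit Types (x y : V) (l : seq (rat * I)).

Definition rat_comb l : V := \sum_(a <- l) ratr a.1 *: c a.2.

(** The closure of the rational span of [c]. *)
Definition rat_span x := forall e : R, 0 < e -> exists l, `|x - rat_comb l| < e.

(** Finite lists of pairs of a rational and an index are countable in number. *)
Lemma rat_span_separable : (forall x, rat_span x) -> separable_space V.
Proof.
move=> spanV; exists (range rat_comb).
  exact: (sub_countable (card_image_le _ _) (countableP _)).
move=> O [x Ox] oO; have /nbhs_ballP[e /= e0 xeO] := open_nbhs_nbhs (conj oO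
  Ox).
have [l xl] := spanV x e e0.
exists (rat_comb l); split; last by exists l.
by apply: xeO; rewrite -ball_normE.
Qed.

Lemma rat_span_gen i : rat_span (c i).
Proof.
move=> e e0; exists [:: (1, i)].
by rewrite /rat_comb big_seq1 /= rmorph1 scale1r subrr normr0.
Qed.

Lemma rat_span0 : rat_span 0.
Proof.
by move=> e e0; exists [::]; rewrite /rat_comb big_nil subrr normr0.
Qed.

Lemma rat_spanD x y : rat_span x -> rat_span y -> rat_span (x + y).
Proof.
move=> sx sy e e0; have e2 : 0 < e / 2 by rewrite divr_gt0.
have [l xl] := sx _ e2; have [k yk] := sy _ e2.
exists (l ++ k); rewrite /rat_comb big_cat/= -!/(rat_comb _) opprD addrACA.
by rewrite (le_lt_trans (ler_normD _ _))//; lra.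
Qed.

Lemma rat_span_closed x :
  (forall e : R, 0 < e -> exists2 y, rat_span y & `|x - y| < e) -> rat_span x.
Proof.
move=> h e e0; have e2 : 0 < e / 2 by rewrite divr_gt0.
have [y sy xy] := h _ e2; have [l yl] := sy _ e2; exists l.
by rewrite -(subrKA y) (le_lt_trans (ler_normD _ _))//; lra.
Qed.

(** Rational multiples are clear, and [ratr q *: x] tends to [a *: x] when the
    rational [q] tends to [a]. *)
Lemma rat_spanZ (a : R) x : rat_span x -> rat_span (a *: x).
Proof.
move=> sx.
have rat_spanZQ q : rat_span (ratr q *: x).
  move=> e e0; have q1 : 0 < `|ratr q : R| + 1 by rewrite ltr_wpDl.
  have [l xl] := sx (e / (`|ratr q| + 1)) (divr_gt0 e0 q1).
  exists [seq (q * p.1, p.2) | p <- l].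
  have -> : rat_comb [seq (q * p.1, p.2) | p <- l] = ratr q *: rat_comb l.
    rewrite /rat_comb big_map scaler_sumr; apply: eq_bigr => p _.
    by rewrite rmorphM scalerA.
  rewrite -scalerBr normrZ; move: xl; rewrite ltr_pdivlMr//.
  by apply: le_lt_trans; rewrite mulrC ler_wpM2l// lerDl.
apply: rat_span_closed => e e0.
have x1 : 0 < `|x| + 1 by rewrite ltr_wpDl.
have d0 : 0 < e / (`|x| + 1) by exact: divr_gt0.
have [|q] := @rat_in_itvoo R (a - e / (`|x| + 1)) (a + e / (`|x| + 1)).
  by lra.
rewrite in_itv/= => /andP[q1 q2]; exists (ratr q *: x) => //.
rewrite -scalerBl normrZ.
have aq : `|a - ratr q| < e / (`|x| + 1) by rewrite ltr_norml; apply/andP;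
  split; lra.
rewrite ltr_pdivlMr// in aq.
by apply: le_lt_trans aq; rewrite ler_wpM2l// lerDl.
Qed.

Lemma rat_span_sum (J : Type) (r : seq J) (F : J -> V) :
  (forall j, rat_span (F j)) -> rat_span (\sum_(j <- r) F j).
Proof.
move=> sF; apply: (big_ind rat_span) => [|x y|j _].
- exact: rat_span0.
- exact: rat_spanD.
- exact: sF.
Qed.

End rational_span.

(** * Sums of normed spaces in the l2 sense *)

Section l2sum_theory.
Context (R : realType) (E : nat -> normedModType R).
Implicit Types (x y : l2sum E) (u : nat -> l2sum E).

Lemma l2sum_coordB x y n : val (x - y) n = val x n - val y n.
Proof. by rewrite raddfB. Qed.

Lemma l2sum_coordD x y n : val (x + y) n = val x n + val y n.
Proof. by rewrite raddfD. Qed.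

Lemma l2sum_coordZ a x n : val (a *: x) n = a *: val x n.
Proof. by rewrite [val (a *: x)]linearZ. Qed.

Lemma l2sum_coord0 n : val (0 : l2sum E) n = 0.
Proof. by rewrite raddf0. Qed.

Lemma l2sum_normE x : ((`|x| ^+ 2)%:E = l2_sqsum (val x))%E.
Proof.
by rewrite [`|x|]/(l2norm x) sqr_sqrtr ?fine_ge0 ?l2_sqsum_ge0// fineK//
  l2sum_sqsum_fin.
Qed.

Lemma l2sum_partial_norm x N : \sum_(0 <= n < N) `|val x n| ^+ 2 <= `|x| ^+ 2.
Proof.
rewrite -lee_fin l2sum_normE -sumEFin; apply: nneseries_lim_ge => n _ _.
by rewrite lee_fin sqr_ge0.
Qed.

Lemma l2sum_coord_norm x n : `|val x n| <= `|x|.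
Proof.
rewrite -(@ler_pXn2r _ 2)// ?nnegrE//.
apply: le_trans (l2sum_partial_norm x n.+1).
by rewrite big_nat_recr//= lerDr sumr_ge0// => k _; rewrite sqr_ge0.
Qed.

Lemma l2_sqsum_le (x : seq_prod E) (C : R) :
  (forall N, \sum_(0 <= n < N) `|x n| ^+ 2 <= C) -> (l2_sqsum x <= C%:E)%E.
Proof.
move=> xC; apply: lime_le.
  by apply: is_cvg_nneseries => n _ _; rewrite lee_fin sqr_ge0.
by apply: nearW => N; rewrite sumEFin lee_fin.
Qed.

Lemma l2sum_norm_le x (C : R) : 0 <= C ->
  (forall N, \sum_(0 <= n < N) `|val x n| ^+ 2 <= C ^+ 2) -> `|x| <= C.
Proof.
move=> C0 xC; rewrite -(@ler_pXn2r _ 2)// ?nnegrE//.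
by rewrite -lee_fin l2sum_normE; exact: l2_sqsum_le.
Qed.

(** A bound on the partial sums is the form in which square summability is
    obtained everywhere below. *)
Definition l2sum_of (x : seq_prod E) (C : R)
    (xC : forall N, \sum_(0 <= n < N) `|x n| ^+ 2 <= C) : l2sum E :=
  exist _ x (introT (square_summableP x) (le_lt_trans (l2_sqsum_le xC) (ltry
    C))).

(** Coordinates have geometric steps too, so the sequence converges
    coordinatewise. The bound [2 * 4^-1 ^+ k] on the distance of [u j] to [u k]
    holds on each partial sum, a finite sum, hence passes to the limit in [j];
    this shows both that the limit is square summable and that it is a limit in
    norm. *)
Lemma l2sum_complete : (forall n, geometric_complete (E n)) ->
  geometric_complete (l2sum E).
Proof.
move=> cE u gu.
pose l : seq_prod E := fun n => lim (val (u k) n @[k --> \oo]).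
have ul n : val (u k) n @[k --> \oo] --> l n.
  apply: cE => k; rewrite -l2sum_coordB.
  exact: le_trans (l2sum_coord_norm _ _) (gu k).
have lu k N :
    \sum_(0 <= n < N) `|(l - val (u k)) n| ^+ 2 <= (2 * 4^-1 ^+ k) ^+ 2.
  have c : \sum_(0 <= n < N) `|val (u j) n - val (u k) n| ^+ 2 @[j --> \oo] -->
      \sum_(0 <= n < N) `|l n - val (u k) n| ^+ 2.
    elim: N => [|N IH].
      by rewrite big_geq//; under eq_fun do rewrite big_geq//; exact: cvg_cst.
    rewrite big_nat_recr//=; under eq_fun do rewrite big_nat_recr//=.
    have cN : `|val (u j) N - val (u k) N| @[j --> \oo] --> `|l N - val (u k)
      N|.
      by apply: cvg_norm; apply: cvgB; [exact: ul|exact: cvg_cst].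
    by apply: (cvgD IH); rewrite expr2; exact: (cvgM cN cN).
  apply: (cvgr_to_le c); exists k => // j /= kj.
  under eq_bigr do rewrite -l2sum_coordB.
  apply: le_trans (l2sum_partial_norm _ _) _.
  rewrite lerXn2r ?nnegrE ?mulr_ge0 ?exprn_ge0 ?invr_ge0//.
  apply: geometric_steps_dist gu kj; lra.
pose y := u 0%N + l2sum_of (lu 0%N).
have yE n : val y n = l n.
  by rewrite l2sum_coordD addrC; exact: subrK.
apply/cvg_ex; exists y; apply/cvgrPdist_le => e e0.
have rc : (2 * 4^-1 ^+ n @[n --> \oo] --> (0 : R)).
  by rewrite -(mulr0 2); apply: cvgMl_tmp; apply: cvg_expr;
    rewrite ger0_norm// invf_lt1// ltr1n.
move/cvgr_distC_le : rc => /(_ _ e0); apply: filterS => k.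
rewrite subr0 ger0_norm ?mulr_ge0 ?exprn_ge0 ?invr_ge0//; apply: le_trans.
apply: l2sum_norm_le => [|N]; first by rewrite mulr_ge0 ?exprn_ge0 ?invr_ge0.
by under eq_bigr do rewrite l2sum_coordB yE; exact: lu.
Qed.

End l2sum_theory.

(** Squares make this form of strict convexity additive, so that it passes to
    sums in the l2 sense; moreover it is homogeneous, while the coordinates of a
    unit vector are not unit vectors. *)
Definition strict_midpoint (R : realType) (V : normedModType R) := forall u v :
  V,
  u != v -> `|2^-1 *: (u + v)| ^+ 2 < (`|u| ^+ 2 + `|v| ^+ 2) / 2.

(** Sum the midpoint inequality over the coordinates: it is weak everywhere and
    strict at a coordinate where the two vectors differ. *)
Lemma l2sum_strictly_convex (R : realType) (E : nat -> normedModType R) :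
  (forall n, strict_midpoint (E n)) -> strictly_convex (l2sum E).
Proof.
move=> sE x y x1 y1 xy.
have [n xyn] : exists n, val x n != val y n.
  apply: contra_neqP xy => /forallNP h; apply: val_inj.
  by apply: functional_extensionality_dep => n; have /negP := h n;
    rewrite negbK => /eqP.
pose F (z : l2sum E) k := ((`|val z k| ^+ 2)%:E : \bar R).
have F0 z k : (0 <= F z k)%E by rewrite lee_fin sqr_ge0.
pose m := 2^-1 *: (x + y).
pose G k := ((2^-1)%:E * (F x k + F y k))%E.
have G0 k : (0 <= G k)%E by rewrite mule_ge0// ?lee_fin ?invr_ge0// adde_ge0.
have mG k : (F m k <= G k)%E.
  rewrite /G /F -EFinD -EFinM lee_fin /m l2sum_coordZ l2sum_coordD mulrC.
  have [->|/sE/ltW//] := eqVneq (val x k) (val y k).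
  suff -> : 2^-1 *: (val y k + val y k) = val y k by lra.
  rewrite scalerDr -scalerDl (_ : _ + _ = 1) ?scale1r//; lra.
have mGn : (F m n < G n)%E.
  rewrite /G /F -EFinD -EFinM lte_fin /m l2sum_coordZ l2sum_coordD mulrC.
  exact: sE.
have S1 (z : l2sum E) : `|z| = 1 -> (\sum_(0 <= k <oo) F z k = 1)%E.
  by move=> z1; have := l2sum_normE z; rewrite z1 expr1n /l2_sqsum => <-.
have GS : (\sum_(0 <= k <oo) G k = 1)%E.
  rewrite /G nneseriesZl; last by move=> k _; rewrite adde_ge0.
  rewrite nneseriesD// (S1 _ x1) (S1 _ y1) -EFinD -EFinM; congr (_%:E); lra.
rewrite -(@ltr_pXn2r _ 2)// ?nnegrE// expr1n -lte_fin l2sum_normE -[ltRHS]GS.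
rewrite /l2_sqsum (@nneseriesD1 _ _ n)// [ltRHS](@nneseriesD1 _ _ n)//.
apply: lte_leD; last 2 first.
- exact: mGn.
- by apply: lee_nneseries => [k _ _|k _]; [exact: F0|exact: mG].
suff: (\sum_(0 <= k <oo | k != n) G k <= 1)%E.
  move=> h; rewrite ge0_fin_numE; last by apply: nneseries_ge0 => k _ _;
    exact: F0.
  apply: le_lt_trans (ltry 1); apply: le_trans h.
  by apply: lee_nneseries => [k _ _|k _]; [exact: F0|exact: mG].
by rewrite -GS [leRHS](@nneseriesD1 _ _ n)// leeDr.
Qed.

Definition countably_spanned (R : realType) (V : normedModType R) :=
  exists (I : countType) (c : I -> V), forall x, rat_span c x.

Section l2sum_spanned.
Context (R : realType) (E : nat -> normedModType R).

Lemma l2_single_sum n (u : E n) N :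
  \sum_(0 <= k < N) `|dfwith (fun k => 0 : E k) n u k| ^+ 2 <= `|u| ^+ 2.
Proof.
have [nN|Nn] := ltnP n N.
  rewrite big_mkord (bigD1 (Ordinal nN))//= dfwithin big1 ?addr0// => k kn.
  by rewrite dfwithout ?normr0 ?expr0n// eq_sym.
rewrite big_nat big1 ?sqr_ge0// => k /andP[_ kN].
by rewrite dfwithout ?normr0 ?expr0n// gtn_eqF// (leq_trans kN).
Qed.

Definition l2single n (u : E n) : l2sum E := l2sum_of (l2_single_sum u).

Lemma l2single_linear n : linear (@l2single n).
Proof.
move=> a u v; apply: val_inj; apply: functional_extensionality_dep => k.
rewrite l2sum_coordD l2sum_coordZ/=.
have [<-|nk] := eqVneq n k; first by rewrite !dfwithin.
by rewrite !dfwithout// scaler0 addr0.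
Qed.

HB.instance Definition _ n :=
  GRing.isLinear.Build R (E n) (l2sum E) _ (@l2single n) (@l2single_linear n).

Lemma l2single_norm n (u : E n) : `|l2single u| <= `|u|.
Proof. by apply: l2sum_norm_le => // N; exact: l2_single_sum. Qed.

(** A vector is the limit of its truncations, which are sums of vectors with a
    single nonzero coordinate. *)
Lemma l2sum_countably_spanned : (forall n, countably_spanned (E n)) ->
  countably_spanned (l2sum E).
Proof.
move=> sE.
pose I n : countType := projT1 (cid (sE n)).
pose c n : I n -> E n := projT1 (cid (projT2 (cid (sE n)))).
have cE n x : rat_span (c n) x := projT2 (cid (projT2 (cid (sE n)))) x.
exists {n : nat & I n}, (fun i : {n : nat & I n} =>
  l2single (c (tag i) (tagged i))) => x.
pose T N := \sum_(0 <= n < N) l2single (val x n).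
have TE N k : val (T N) k = if (k < N)%N then val x k else 0.
  rewrite /T; elim: N => [|N IH]; first by rewrite big_geq// l2sum_coord0.
  rewrite big_nat_recr// l2sum_coordD IH/=.
  have [kN|kN|<-] := ltngtP k N.
  - by rewrite ltnS ltnW// dfwithout ?addr0// gtn_eqF.
  - by rewrite ltnS leqNgt kN/= dfwithout ?addr0// ltn_eqF.
  - by rewrite ltnS leqnn dfwithin add0r.
apply: rat_span_closed => e e0.
pose F n := ((`|val x n| ^+ 2)%:E : \bar R).
have F0 n : (0 <= F n)%E by rewrite lee_fin sqr_ge0.
have tail0 : (\sum_(N <= k <oo) F k @[N --> \oo] --> (0 : \bar R))%E.
  by apply: nneseries_tail_cvg => //; exact/square_summableP/(valP x).
have e20 : 0 < e ^+ 2 by rewrite exprn_gt0.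
have /fine_cvgP[tfin /cvgrPdistC_lt/(_ _ e20) tlt] := tail0.
have [N _ /(_ _ (leqnn N)) [/= tNfin tN]] := filterI tfin tlt.
exists (T N); last first.
  rewrite -(@ltr_pXn2r _ 2)// ?nnegrE// ?ltW//.
  have -> : `|x - T N| ^+ 2 = fine (\sum_(N <= k <oo) F k)%E.
    apply: EFin_inj; rewrite fineK// l2sum_normE /l2_sqsum.
    rewrite (@nneseries_split _ _ 0%N N); last by move=> k _;
      rewrite lee_fin sqr_ge0.
    rewrite add0n big_nat big1 ?add0e.
      rewrite eseries_cond [RHS]eseries_cond;
        apply: eq_eseriesr => k /andP[_ Nk].
      by rewrite l2sum_coordB TE ltnNge Nk subr0.
    by move=> k /andP[_ kN]; rewrite l2sum_coordB TE kN subrr normr0 expr0n.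
  by move: tN; rewrite subr0; apply: le_lt_trans; rewrite ler_norm.
apply: rat_span_sum => n; apply: rat_span_closed => r r0.
have [l xl] := cE n (val x n) r r0.
exists (l2single (rat_comb (c n) l)).
  rewrite /rat_comb linear_sum; apply: rat_span_sum => -[q i] /=.
  rewrite linearZ; apply: rat_spanZ.
  exact: (rat_span_gen (fun i : {n : nat & I n} =>
    l2single (c (tag i) (tagged i))) (Tagged I i)).
by rewrite -linearB; apply: le_lt_trans xl; exact: l2single_norm.
Qed.

End l2sum_spanned.

(** * Function representatives in Lebesgue spaces of even exponent *)

Section even_Lspace.
Context d (T : measurableType d) (R : realType).
Variables (mu : {measure set T -> \bar R}) (n : nat).
Local Notation p := (2 * n.+1)%N.
Local Notation E := (LspaceType mu (exponent_ge1 R n)).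
Implicit Types (u v : E) (f g : T -> R).

(** Elements of a Lebesgue space are handled through a representative; the
    lemmas of this part say that it is determined, and compatible with the
    operations, up to a null set. *)
Definition Lrepr u : {mfun T >-> R} := ae_repr (val u).

Lemma pow_even_ge0 (r : R) : 0 <= r ^+ p.
Proof. by rewrite exprM exprn_ge0// sqr_ge0. Qed.

(** For an even exponent the absolute value disappears from the integrals that
    define the norm. *)
Lemma pow_even_norm (r : R) : `|r| ^+ p = r ^+ p.
Proof. by rewrite -normrX ger0_norm// pow_even_ge0. Qed.

Lemma measurable_pow_even f : measurable_fun setT f ->
  measurable_fun setT (fun x => (f x ^+ p)%:E).
Proof. by move=> mf; apply/measurable_EFinP; exact: measurable_funX. Qed.

Lemma poweR_even (r : R) : (`|r%:E| `^ (p%:R))%E = (r ^+ p)%:E.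
Proof. by rewrite abse_EFin poweR_EFin powR_mulrn// pow_even_norm. Qed.

Lemma Lspace_pow_normE u :
  ((`|u| ^+ p)%:E = \int[mu]_x ((Lrepr u x) ^+ p)%:E)%E.
Proof.
have p0 : (p%:R : R) != 0 by rewrite pnatr_eq0.
rewrite -poweR_even.
rewrite [(`|u|)%:E]Lspace_normE gee0_abs ?Lnorm_ge0// poweR_Lnorm//.
by apply: eq_integral => x _; rewrite poweR_even.
Qed.

(** Any function equal to the representative almost everywhere computes the
    norm. *)
Lemma Lspace_pow_norm u f : measurable_fun setT f ->
  (Lrepr u : T -> R) = f %[ae mu] ->
  ((`|u| ^+ p)%:E = \int[mu]_x (f x ^+ p)%:E)%E.
Proof.
move=> mf uf; rewrite Lspace_pow_normE; apply: ge0_ae_eq_integral => //.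
- exact: measurable_pow_even.
- exact: measurable_pow_even.
- by move=> x _; rewrite lee_fin pow_even_ge0.
- by move=> x _; rewrite lee_fin pow_even_ge0.
- by apply: filterS uf => x ufx xT; rewrite ufx.
Qed.

Lemma LreprB u v : (Lrepr (u - v) : T -> R) = Lrepr u \- Lrepr v %[ae mu].
Proof.
have e : val (u - v) = ae_pi mu (Lrepr u - Lrepr v).
  by rewrite raddfB ae_piD ae_piN !ae_reprK.
apply: filterS (ae_repr_pi mu (Lrepr u - Lrepr v)) => x ux xT.
by rewrite /Lrepr e ux.
Qed.

Lemma LreprD u v : (Lrepr (u + v) : T -> R) = Lrepr u \+ Lrepr v %[ae mu].
Proof.
have e : val (u + v) = ae_pi mu (Lrepr u + Lrepr v).
  by rewrite raddfD ae_piD !ae_reprK.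
apply: filterS (ae_repr_pi mu (Lrepr u + Lrepr v)) => x ux xT.
by rewrite /Lrepr e ux.
Qed.

Lemma LreprZ a u :
  (Lrepr (a *: u) : T -> R) = (fun x => a * Lrepr u x) %[ae mu].
Proof.
have e : val (a *: u) = ae_pi mu (a *: Lrepr u).
  by rewrite [val (a *: u)]linearZ ae_piZ !ae_reprK.
apply: filterS (ae_repr_pi mu (a *: Lrepr u)) => x ux xT.
by rewrite /Lrepr e ux.
Qed.

Lemma Lspace_class f : measurable_fun setT f ->
  (\int[mu]_x (f x ^+ p)%:E < +oo)%E ->
  exists u, (Lrepr u : T -> R) = f %[ae mu].
Proof.
move=> mf fp; pose F : {mfun T >-> R} := mfun_Sub (mem_set mf).
have finF : finite_norm mu p%:R%:E F.
  rewrite /finite_norm unlock; apply: poweR_lty.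
  by under eq_integral do rewrite poweR_even.
exists (Lspace_Sub (exponent_ge1 R n) (finite_norm_ae_pi (exponent_ge1 R n)
  finF)).
exact: ae_repr_pi.
Qed.

End even_Lspace.

(** * Strict convexity of Lebesgue spaces of even exponent *)

Section clarkson.
Context (R : realFieldType).
Implicit Types (a b s t : R) (m n : nat).

Lemma exprD_superadditive s t m : 0 <= s -> 0 <= t ->
  s ^+ m.+1 + t ^+ m.+1 <= (s + t) ^+ m.+1.
Proof.
move=> s0 t0; elim: m => [|m IH]; first by rewrite !expr1.
have st0 : 0 <= s + t by exact: addr_ge0.
rewrite exprS [t ^+ _]exprS [leRHS]exprS.
apply: (le_trans _ (ler_wpM2l st0 IH)).
have := mulr_ge0 s0 (exprn_ge0 m.+1 t0);
  have := mulr_ge0 t0 (exprn_ge0 m.+1 s0).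
lra.
Qed.

Lemma exprn_midpoint_convex s t m : 0 <= s -> 0 <= t ->
  ((s + t) / 2) ^+ m <= (s ^+ m + t ^+ m) / 2.
Proof.
move=> s0 t0; elim: m => [|m IH]; first by rewrite !expr0; lra.
have st0 : 0 <= (s + t) / 2 by rewrite divr_ge0// addr_ge0.
rewrite exprS; apply: (le_trans (ler_wpM2l st0 IH)).
have : 0 <= (s - t) * (s ^+ m - t ^+ m).
  have [st|/ltW st] := leP s t.
    by rewrite mulr_le0// subr_le0// lerXn2r.
  by rewrite mulr_ge0// subr_ge0// lerXn2r.
rewrite !exprS; lra.
Qed.

(** By the parallelogram law, the squares [s] and [t] of half the sum and half
    the difference satisfy [s + t = (a ^+ 2 + b ^+ 2) / 2]; the power [n.+1] is
    superadditive and convex on nonnegative numbers. *)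
Lemma clarkson_even a b n :
  (2^-1 * (a + b)) ^+ (2 * n.+1) + (2^-1 * (a - b)) ^+ (2 * n.+1)
  <= 2^-1 * (a ^+ (2 * n.+1) + b ^+ (2 * n.+1)).
Proof.
rewrite !exprM (le_trans (exprD_superadditive n (sqr_ge0 _) (sqr_ge0 _)))//.
have -> : (2^-1 * (a + b)) ^+ 2 + (2^-1 * (a - b)) ^+ 2 = (a ^+ 2 + b ^+ 2) / 2.
  by field.
by rewrite [leRHS]mulrC exprn_midpoint_convex// sqr_ge0.
Qed.

End clarkson.

Section even_Lspace_geometry.
Context d (T : measurableType d) (R : realType).
Variables (mu : {measure set T -> \bar R}) (n : nat).
Local Notation p := (2 * n.+1)%N.
Local Notation E := (LspaceType mu (exponent_ge1 R n)).
Implicit Types (u v : E) (f g : T -> R).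

Lemma Lspace_clarkson u v :
  `|2^-1 *: (u + v)| ^+ p + `|2^-1 *: (u - v)| ^+ p
  <= 2^-1 * (`|u| ^+ p + `|v| ^+ p).
Proof.
have mu_ : measurable_fun setT (Lrepr u) by [].
have mv_ : measurable_fun setT (Lrepr v) by [].
have mp : measurable_fun setT (fun x => 2^-1 * (Lrepr u x + Lrepr v x)).
  by apply: measurable_funM => //; exact: measurable_funD.
have mm : measurable_fun setT (fun x => 2^-1 * (Lrepr u x - Lrepr v x)).
  by apply: measurable_funM => //; exact: measurable_funB.
rewrite -lee_fin EFinD EFinM EFinD.
rewrite (@Lspace_pow_norm _ _ _ _ _ (2^-1 *: (u + v)) _ mp); last first.
  apply: filterS2 (LreprZ 2^-1 (u + v)) (LreprD u v) => x h1 h2 xT.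
  by rewrite h1// h2.
rewrite (@Lspace_pow_norm _ _ _ _ _ (2^-1 *: (u - v)) _ mm); last first.
  apply: filterS2 (LreprZ 2^-1 (u - v)) (LreprB u v) => x h1 h2 xT.
  by rewrite h1// h2.
rewrite !Lspace_pow_normE.
have ge0 (h : T -> R) x : setT x -> (0 <= (h x ^+ p)%:E)%E.
  by move=> _; rewrite lee_fin pow_even_ge0.
rewrite -!ge0_integralD//; try exact: ge0; try exact: measurable_pow_even.
rewrite -ge0_integralZl_EFin//; first last.
  by apply: emeasurable_funD; exact: measurable_pow_even.
  by move=> x _; apply: adde_ge0; rewrite lee_fin pow_even_ge0.
apply: ge0_le_integral.
- exact: measurableT.
- by move=> x _; apply: adde_ge0; rewrite lee_fin pow_even_ge0.
- by apply: emeasurable_funD; exact: measurable_pow_even.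
- by apply: measurable_funeM; apply: emeasurable_funD;
    exact: measurable_pow_even.
- by move=> x _; rewrite -!EFinD -EFinM lee_fin clarkson_even.
Qed.

(** If the norms differ, the triangle inequality and the strict convexity of the
    square suffice; if they agree, Clarkson's inequality bounds the norm of the
    midpoint away from the common value by the norm of the half difference. *)
Lemma Lspace_strict_midpoint : strict_midpoint E.
Proof.
have half (z : R) : z = 2^-1 * (z + z) by lra.
move=> u v uv.
have [uvn|uvn] := eqVneq `|u| `|v|; last first.
  have h : `|2^-1 *: (u + v)| <= 2^-1 * (`|u| + `|v|).
    by rewrite normrZ gtr0_norm// ler_wpM2l// ler_normD.
  apply: (@le_lt_trans _ _ ((2^-1 * (`|u| + `|v|)) ^+ 2)).
    by rewrite lerXn2r// nnegrE// mulr_ge0// addr_ge0.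
  rewrite -subr_gt0.
  have -> : (`|u| ^+ 2 + `|v| ^+ 2) / 2 - (2^-1 * (`|u| + `|v|)) ^+ 2 =
      (2^-1 * (`|u| - `|v|)) ^+ 2 by field.
  by rewrite exprn_even_gt0//= mulf_neq0// subr_eq0.
have := Lspace_clarkson u v; rewrite uvn => h.
have w0 : 0 < `|2^-1 *: (u - v)| ^+ p.
  by rewrite exprn_gt0// normr_gt0 scaler_eq0 negb_or subr_eq0 uv invr_eq0
    pnatr_eq0.
have lt : `|2^-1 *: (u + v)| ^+ p < `|v| ^+ p.
  by rewrite [ltRHS]half; apply: lt_le_trans h; rewrite ltrDl.
rewrite ltr_pXn2r ?nnegrE// in lt.
have : `|2^-1 *: (u + v)| ^+ 2 < `|v| ^+ 2 by rewrite ltr_pXn2r ?nnegrE.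
by rewrite [X in _ < X -> _]half [_ / 2]mulrC.
Qed.

End even_Lspace_geometry.

(** * Completeness of Lebesgue spaces *)

Lemma geometric_sum_le2 (R : realFieldType) N :
  \sum_(0 <= k < N) (4^-1 : R) ^+ k <= 2.
Proof.
suff : \sum_(0 <= k < N) (4^-1 : R) ^+ k <= 2 - 2 * 4^-1 ^+ N.
  by move/le_trans; apply; rewrite gerBl mulr_ge0// exprn_ge0.
elim: N => [|N IH]; first by rewrite big_geq// expr0; lra.
rewrite big_nat_recr//= exprS.
have : 0 <= 4^-1 ^+ N :> R by rewrite exprn_ge0.
lra.
Qed.

Section riesz_fischer.
Context d (T : measurableType d) (R : realType).
Variables (mu : {measure set T -> \bar R}) (n : nat).
Local Notation p := (2 * n.+1)%N.
Local Notation E := (LspaceType mu (exponent_ge1 R n)).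

(** The series of the [(4 ^+ k * (f k.+1 - f k) ^+ 2) ^+ n.+1] has finite
    integral, the weight [4 ^+ k] being absorbed by the ratio [4^-1] of the
    steps. Hence almost everywhere its terms are eventually less than 1, which
    says that the steps of [f k x] are at most [2^-1 ^+ k]. *)
Lemma Lrepr_ae_cvg (u : nat -> E) : geometric_steps 4^-1 u ->
  {ae mu, forall x, cvgn (fun k => Lrepr (u k) x)}.
Proof.
move=> gu; pose f k := Lrepr (u k) : T -> R.
have mf k : measurable_fun setT (f k) by [].
pose S k x : \bar R := ((4 ^+ k * (f k.+1 x - f k x) ^+ 2) ^+ n.+1)%:E.
have SE k x : S k x = (((4 ^+ k) ^+ n.+1)%:E * ((f k.+1 x - f k x) ^+ p)%:E)%E.
  by rewrite /S exprMn -[(_ ^+ 2) ^+ _]exprM EFinM.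
have S0 k x : (0 <= S k x)%E.
  by rewrite lee_fin exprn_ge0// mulr_ge0// ?sqr_ge0// exprn_ge0.
have mB k : measurable_fun setT (fun x => f k.+1 x - f k x).
  exact: measurable_funB.
have mS k : measurable_fun setT (S k).
  apply/measurable_EFinP; apply: measurable_funX; apply: measurable_funM => //.
  exact: measurable_funX.
have intS k : (\int[mu]_x S k x <= (4^-1 ^+ k)%:E)%E.
  under eq_integral do rewrite SE.
  rewrite ge0_integralZl_EFin; last 4 first.
  - exact: measurableT.
  - by move=> x _; rewrite lee_fin pow_even_ge0.
  - exact: measurable_pow_even (mB k).
  - by rewrite exprn_ge0// exprn_ge0.
  rewrite -(@Lspace_pow_norm _ _ _ _ _ (u k.+1 - u k) _ (mB k));
    last exact: LreprB.
  rewrite -EFinM lee_fin.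
  have h : `|u k.+1 - u k| ^+ p <= (4^-1 ^+ k) ^+ p.
    by rewrite lerXn2r ?nnegrE ?exprn_ge0.
  apply: (le_trans (ler_wpM2l _ h)); first by rewrite exprn_ge0// exprn_ge0.
  rewrite exprM -exprMn [_ ^+ 2]expr2 mulrA -exprMn divff// expr1n mul1r.
  rewrite -[leRHS]expr1 ler_wiXn2l ?exprn_ge0//.
  by rewrite exprn_ile1// invf_le1// ler1n.
have Sint : mu.-integrable setT (fun x => \sum_(0 <= k <oo) S k x)%E.
  apply/integrableP; split.
    exact: ge0_emeasurable_sum.
  under eq_integral do rewrite gee0_abs ?nneseries_ge0//.
  rewrite integral_nneseries//.
  apply: (@le_lt_trans _ _ 2%:E); last exact: ltry.
  apply: lime_le.
    by apply: is_cvg_nneseries => k _ _; apply: integral_ge0.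
  apply: nearW => N; apply: (le_trans (lee_sum _ (fun k _ => intS k))).
  by rewrite sumEFin lee_fin geometric_sum_le2.
apply: filterS (integrable_ae measurableT Sint) => x /(_ Logic.I) Sfin.
have tail0 : (\sum_(N <= k <oo) S k x @[N --> \oo] --> (0 : \bar R))%E.
  by apply: nneseries_tail_cvg => //; rewrite -ge0_fin_numE// nneseries_ge0.
have /fine_cvgP[tfin /cvgrPdistC_lt/(_ _ ltr01) tlt] := tail0.
have [N _ NS] := filterI tfin tlt.
have step k : (N <= k)%N -> `|f k.+1 x - f k x| <= 2^-1 ^+ k.
  move=> /NS[/= kfin]; rewrite subr0 => klt.
  have : (S k x < 1)%E.
    apply: (@le_lt_trans _ _ (\sum_(k <= j <oo) S j x)%E).
      apply: le_trans (@nneseries_lim_ge _ _ xpredT k k.+1 _) => //.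
      by rewrite big_nat1.
    by rewrite -(fineK kfin) lte_fin (le_lt_trans (ler_norm _)).
  rewrite lte_fin expr_lt1// => [h|];
    last by rewrite mulr_ge0 ?sqr_ge0// exprn_ge0.
  rewrite -(@ler_pXn2r _ 2)// ?nnegrE ?exprn_ge0// real_normK ?num_real//.
  have -> : (2^-1 ^+ k) ^+ 2 = (4 ^+ k)^-1 :> R.
    by rewrite -exprM mulnC exprM -exprVn; congr (_ ^+ k); lra.
  by rewrite -[leRHS]mul1r ler_pdivlMr ?exprn_gt0// mulrC ltW.
have gN : geometric_steps 2^-1 (fun j => f (j + N)%N x).
  move=> j; rewrite addSn (le_trans (step _ (leq_addl _ _)))//.
  by rewrite ler_wiXn2l ?leq_addr// invf_le1// ler1n.
have /cvg_ex[l fl] := geometric_steps_cvg gN.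
by apply/cvg_ex; exists l; rewrite -(cvg_shiftn N).
Qed.

(** Riesz-Fischer: the sequence converges almost everywhere, and Fatou's lemma
    bounds the distance of the pointwise limit to [u k]. *)
Lemma Lspace_complete : geometric_complete E.
Proof.
move=> u gu; pose f k := Lrepr (u k) : T -> R.
have mf k : measurable_fun setT (f k) by [].
(* The upper limit is measurable whether or not the sequence converges. *)
pose F x := fine (limn_esup (fun k => (f k x)%:E)).
have mF : measurable_fun setT F.
  apply: measurableT_comp => //; apply: measurable_fun_limn_esup => k.
  exact/measurable_EFinP.
have fF : {ae mu, forall x, f k x @[k --> \oo] --> F x}.
  apply: filterS (Lrepr_ae_cvg gu) => x /cvg_ex[l fl].
  suff -> : F x = l by [].
  have /cvg_limn_einf_sup[_ h] : (f k x)%:E @[k --> \oo] --> l%:E.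
    by apply: cvg_EFin => //; exact: nearW.
  by rewrite /F h.
have fatouF k :
    (\int[mu]_x ((F x - f k x) ^+ p)%:E <= ((2 * 4^-1 ^+ k) ^+ p)%:E)%E.
  (* Fatou's lemma for the tail, each term of which satisfies the bound. *)
  have mD j : measurable_fun setT (fun x => f (j + k)%N x - f k x).
    exact: measurable_funB.
  pose h j x : \bar R := ((f (j + k)%N x - f k x) ^+ p)%:E.
  have mh j : measurable_fun setT (h j) by exact: measurable_pow_even.
  have h0 j x : (0 <= h j x)%E by rewrite lee_fin pow_even_ge0.
  have hF : {ae mu, forall x, limn_einf (h^~ x) = ((F x - f k x) ^+ p)%:E}.
    apply: filterS fF => x fx.
    have [-> //] : (limn_einf (h^~ x) = ((F x - f k x) ^+ p)%:E) *
             (limn_esup (h^~ x) = ((F x - f k x) ^+ p)%:E).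
    apply: cvg_limn_einf_sup; apply: cvg_EFin; first exact: nearW.
    have fk : f (j + k)%N x - f k x @[j --> \oo] --> F x - f k x.
      by apply: cvgB; [rewrite (cvg_shiftn k (f^~ x))|exact: cvg_cst].
    exact: (cvg_comp _ _ fk (@exprn_continuous R p _)).
  have -> : (\int[mu]_x ((F x - f k x) ^+ p)%:E =
      \int[mu]_x limn_einf (h^~ x))%E.
    apply: ge0_ae_eq_integral => //.
    - by apply: measurable_pow_even; exact: measurable_funB.
    - apply: measurableT_comp => //.
      by apply: measurable_fun_limn_esup => j; apply: measurableT_comp.
    - by move=> x _; rewrite lee_fin pow_even_ge0.
    - move=> x _; rewrite limn_einf_lim; apply: lime_ge;
        first exact: is_cvg_einfs.
      by apply: nearW => j; apply: le_ereal_inf_tmp => _ [i _ <-].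
    - by apply: filterS hF => x ->.
  apply: (le_trans (fatou _ measurableT mh _)) => //.
  rewrite limn_einf_lim; apply: lime_le; first exact: is_cvg_einfs.
  apply: nearW => j; apply: (@le_trans _ _ (\int[mu]_x h j x)%E).
    by apply: ereal_inf_lbound; exists j => //=.
  rewrite -(@Lspace_pow_norm _ _ _ _ _ (u (j + k)%N - u k) _ (mD j));
    last exact: LreprB.
  rewrite lee_fin lerXn2r ?nnegrE ?mulr_ge0 ?exprn_ge0//.
  apply: geometric_steps_dist gu (leq_addl _ _); lra.
have mF0 : measurable_fun setT (fun x => F x - f 0%N x).
  exact: measurable_funB.
have [w wF] : exists w : E,
    (Lrepr w : T -> R) = (fun x => F x - f 0%N x) %[ae mu].
  by apply: Lspace_class => //; exact: le_lt_trans (fatouF 0%N) (ltry _).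
have yF : (Lrepr (w + u 0%N) : T -> R) = F %[ae mu].
  by apply: filterS2 (LreprD w (u 0%N)) wF => x h1 h2 xT;
    rewrite h1//= h2// subrK.
apply/cvg_ex; exists (w + u 0%N); apply/cvgrPdist_le => e e0.
have rc : (2 * 4^-1 ^+ n @[n --> \oo] --> (0 : R)).
  by rewrite -(mulr0 2); apply: cvgMl_tmp; apply: cvg_expr;
    rewrite ger0_norm// invf_lt1// ltr1n.
move/cvgr_distC_le : rc => /(_ _ e0); apply: filterS => k.
rewrite subr0 ger0_norm ?mulr_ge0 ?exprn_ge0 ?invr_ge0//; apply: le_trans.
rewrite -(@ler_pXn2r _ p)// ?nnegrE ?mulr_ge0 ?exprn_ge0//.
rewrite -lee_fin (@Lspace_pow_norm _ _ _ _ _ _ (fun x => F x - f k x))//.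
  exact: measurable_funB.
by apply: filterS2 (LreprB (w + u 0%N) (u k)) yF => x h1 h2 xT;
  rewrite h1//= h2.
Qed.

End riesz_fischer.

(** * Separability of Lebesgue spaces *)

(** The family [C] is dense for the pseudometric given by the measure of the
    symmetric difference, on sets of finite measure. *)
Definition measure_dense d (T : measurableType d) (R : realType)
    (mu : {measure set T -> \bar R}) (I : Type) (C : I -> set T) :=
  (forall i, measurable (C i) /\ (mu (C i) < +oo)%E) /\
  forall A, measurable A -> (mu A < +oo)%E -> forall e : R, 0 < e ->
    exists i, (mu (A `\` C i) + mu (C i `\` A) < e%:E)%E.

Lemma pos_sub_neg_part (R : realDomainType) (r : R) :
  Num.max r 0 - Num.max (- r) 0 = r.
Proof.
have [r0|r0] := leP r 0; first by rewrite max_l ?oppr_ge0// sub0r opprK.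
by rewrite max_r ?subr0// oppr_le0 ltW.
Qed.

Import HBNNSimple.

Section Lspace_separable.
Context d (T : measurableType d) (R : realType).
Variables (mu : {measure set T -> \bar R}) (n : nat).
Local Notation p := (2 * n.+1)%N.
Local Notation E := (LspaceType mu (exponent_ge1 R n)).
Implicit Types (u v : E) (f g : T -> R) (A B : set T).

Lemma Lrepr_inj u v f : (Lrepr u : T -> R) = f %[ae mu] ->
  (Lrepr v : T -> R) = f %[ae mu] -> u = v.
Proof.
move=> uf vf; apply/eqP; rewrite -subr_eq0 -normr_eq0.
have : (`|u - v| ^+ p)%:E = 0%E.
  rewrite (@Lspace_pow_norm _ _ _ _ _ _ (cst 0))//.
    by rewrite integral0_eq// => x _; rewrite /cst expr0n.
  apply: filterS3 (LreprB u v) uf vf => x h1 h2 h3 xT.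
  by rewrite h1//= h2// h3// subrr.
by move=> [] /eqP; rewrite expf_eq0.
Qed.

Lemma pow_indicB A B x :
  (\1_A x - \1_B x : R) ^+ p = \1_(A `\` B) x + \1_(B `\` A) x.
Proof.
rewrite !indicE !in_setD.
case: (x \in A); case: (x \in B) => /=;
  rewrite ?subrr ?subr0 ?addr0 ?add0r ?expr1n ?expr0n//.
by rewrite exprM sqrrN !expr1n.
Qed.

Lemma integral_pow_indic A : measurable A ->
  (\int[mu]_x ((\1_A x : R) ^+ p)%:E)%E = mu A.
Proof.
move=> mA.
have := @integral_indic _ _ _ mu _ measurableT A mA; rewrite setIT => <-.
apply: eq_integral => x _; rewrite indicE.
by case: (_ \in _); rewrite ?expr1n ?expr0n.
Qed.

Lemma Lspace_indic A : measurable A -> (mu A < +oo)%E ->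
  exists u, (Lrepr u : T -> R) = \1_A %[ae mu].
Proof.
move=> mA fA; apply: Lspace_class; first exact: measurable_indic.
by rewrite integral_pow_indic.
Qed.

(** The difference of two indicators has values in -1, 0, 1, so its even powers
    are the indicator of the symmetric difference. *)
Lemma Lspace_indic_dist u v A B : measurable A -> measurable B ->
  (Lrepr u : T -> R) = \1_A %[ae mu] -> (Lrepr v : T -> R) = \1_B %[ae mu] ->
  ((`|u - v| ^+ p)%:E = mu (A `\` B) + mu (B `\` A))%E.
Proof.
move=> mA mB uA vB.
have mAB : measurable (A `\` B) by exact: measurableD.
have mBA : measurable (B `\` A) by exact: measurableD.
rewrite (@Lspace_pow_norm _ _ _ _ _ _ (fun x => \1_A x - \1_B x))//.
- under eq_integral do rewrite pow_indicB EFinD.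
  rewrite ge0_integralD//; try by move=> x _; rewrite lee_fin.
  + by rewrite !integral_indic// !setIT.
  + by apply/measurable_EFinP; exact: measurable_indic.
  + by apply/measurable_EFinP; exact: measurable_indic.
- by apply: measurable_funB; exact: measurable_indic.
- apply: filterS3 (LreprB u v) uA vB => x h1 h2 h3 xT.
  by rewrite h1//= h2// h3.
Qed.

Variables (I : countType) (C : I -> set T).
Hypothesis dC : measure_dense mu C.

Definition indic_class i : E :=
  projT1 (cid (Lspace_indic (dC.1 i).1 (dC.1 i).2)).

Lemma indic_classE i : (Lrepr (indic_class i) : T -> R) = \1_(C i) %[ae mu].
Proof. exact: projT2 (cid (Lspace_indic (dC.1 i).1 (dC.1 i).2)). Qed.

Local Notation span := (rat_span indic_class).

Lemma span_indic u A : measurable A -> (mu A < +oo)%E ->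
  (Lrepr u : T -> R) = \1_A %[ae mu] -> span u.
Proof.
move=> mA fA uA; apply: rat_span_closed => e e0.
have [i Ai] := dC.2 _ mA fA _ (exprn_gt0 p e0).
exists (indic_class i); first exact: rat_span_gen.
rewrite -(@ltr_pXn2r _ p)// ?nnegrE ?(ltW e0)// -lte_fin.
by rewrite (Lspace_indic_dist mA (dC.1 i).1 uA (indic_classE i)).
Qed.

(** Level sets of a simple function at nonzero values have finite measure, since
    its norm is finite. *)
Lemma span_simple u (g : {nnsfun T >-> R}) :
  (Lrepr u : T -> R) = g %[ae mu] -> span u.
Proof.
move=> ug.
have gfin y : y != 0 -> (mu (g @^-1` [set y]) < +oo)%E.
  move=> y0; have yp : 0 < y ^+ p by rewrite lt_def pow_even_ge0 expf_neq0.
  have : ((y ^+ p)%:E * mu (g @^-1` [set y]) <= (`|u| ^+ p)%:E)%E.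
    have my := measurable_funPTI g (measurable_set1 y).
    have := @integral_indic _ _ _ mu _ measurableT _ my.
    rewrite setIT => <-; rewrite (Lspace_pow_norm _ ug)//.
    have mi : measurable_fun setT (fun x => (\1_(g @^-1` [set y]) x : R)%:E).
      by apply/measurable_EFinP; exact: measurable_indic.
    rewrite -ge0_integralZl_EFin; last 4 first.
    - exact: measurableT.
    - by move=> x _; rewrite lee_fin.
    - exact: mi.
    - exact: ltW.
    apply: ge0_le_integral.
    - exact: measurableT.
    - by move=> x _; rewrite -EFinM lee_fin mulr_ge0// ltW.
    - exact: measurable_funeM.
    - exact: measurable_pow_even.
    - move=> x _; rewrite -EFinM lee_fin indicE.
      have [|_] := boolP (x \in _); last by rewrite mulr0 pow_even_ge0.
      by rewrite inE/= => ->; rewrite mulr1.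
  move=> h; rewrite ltey; apply/eqP => gy; move: h.
  by rewrite gy gt0_muley ?lte_fin// leye_eq.
(* The partial sums of the decomposition along level sets; the value 0, whose
   level set may have infinite measure, contributes nothing. *)
have sums (s : seq R) : exists2 w : E, span w &
    (Lrepr w : T -> R) = (fun x => \sum_(y <- s) y * \1_(g @^-1` [set y]) x)
      %[ae mu].
  elim: s => [|y s [w sw wE]].
    exists 0; first exact: rat_span0.
    apply: filterS (LreprB 0 (0 : E)) => x; rewrite subr0 => h xT.
    by rewrite h//= subrr big_nil.
  have [->|y0] := eqVneq y 0.
    by exists w => //; apply: filterS wE => x h xT;
      rewrite h// big_cons mul0r add0r.
  have my := measurable_funPTI g (measurable_set1 y).
  have [v vE] := Lspace_indic my (gfin _ y0).
  exists (y *: v + w).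
    apply: rat_spanD => //; apply: rat_spanZ.
    exact: span_indic my (gfin _ y0) vE.
  apply: filterS3 (filterI (LreprD (y *: v) w) (LreprZ y v)) vE wE =>
    x [h1 h2] h3 h4 xT.
  by rewrite h1//= h2// h3// h4// big_cons.
have [w sw wE] := sums (finmap.enum_fset (fset_set (range g))).
suff -> : u = w by [].
apply: Lrepr_inj ug _; apply: filterS wE => x h xT.
by rewrite h// fimfunE fsbig_finite.
Qed.

(** Simple functions increasing to [f] converge to it in norm by dominated
    convergence. *)
Lemma span_ge0 u f : measurable_fun setT f -> (forall x, 0 <= f x) ->
  (Lrepr u : T -> R) = f %[ae mu] -> span u.
Proof.
move=> mf f0 uf.
have mEf : measurable_fun setT (EFin \o f) by exact/measurable_EFinP.
pose g := nnsfun_approx measurableT mEf.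
have gf k x : g k x <= f x.
  by rewrite -lee_fin /g nnsfun_approxE; apply: le_approx => // y _;
    rewrite lee_fin.
have gcvg x : g k x @[k --> \oo] --> f x.
  have EF0 y : setT y -> (0 <= (EFin \o f) y)%E by move=> _; rewrite lee_fin.
  by have /fine_cvgP[_] := @cvg_nnsfun_approx _ _ _ _ measurableT _ mEf EF0 x
    Logic.I.
have mB k : measurable_fun setT (fun x => f x - g k x).
  exact: measurable_funB.
have intf : (\int[mu]_x (f x ^+ p)%:E < +oo)%E.
  by rewrite -(Lspace_pow_norm _ uf)// ltry.
have [_ _ dom] : [/\ mu.-integrable setT (cst 0%E : T -> \bar R),
    [sequence \int[mu]_(x in setT) `|((f x - g k x) ^+ p)%:E - 0|]_k @ \oo
       --> 0%E &
    [sequence \int[mu]_(x in setT) ((f x - g k x) ^+ p)%:E]_k @ \oo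
       --> (\int[mu]_(x in setT) 0)%E]%E.
  apply: (@dominated_convergence _ _ _ mu setT measurableT _ _ (fun x =>
    (f x ^+ p)%:E)) => //.
  - by move=> k; exact: measurable_pow_even (mB k).
  - apply: nearW => x _; apply: cvg_EFin; first exact: nearW.
    have h : f x - g k x @[k --> \oo] --> 0.
      by rewrite -(subrr (f x)); apply: cvgB; [exact: cvg_cst|exact: gcvg].
    have := cvg_comp _ _ h (@exprn_continuous R p _).
    by rewrite expr0n.
  - apply/integrableP; split; first exact: measurable_pow_even.
    by under eq_integral do rewrite gee0_abs ?lee_fin ?pow_even_ge0//.
  - apply: nearW => x k _; rewrite gee0_abs ?lee_fin ?pow_even_ge0//.
    by rewrite lerXn2r ?nnegrE ?subr_ge0// gerBl.
rewrite integral0 in dom.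
apply: rat_span_closed => e e0.
have ep : 0 < e ^+ p by rewrite exprn_gt0.
have /fine_cvgP[dfin /cvgrPdistC_lt/(_ _ ep) dlt] := dom.
have [N _ /(_ _ (leqnn N)) [/= Nfin Nlt]] := filterI dfin dlt.
have [v vE] : exists v : E, (Lrepr v : T -> R) = g N %[ae mu].
  apply: Lspace_class => //; apply: le_lt_trans intf;
    apply: ge0_le_integral => //.
  - by move=> x _; rewrite lee_fin pow_even_ge0.
  - exact: measurable_pow_even.
  - exact: measurable_pow_even.
  - by move=> x _; rewrite lee_fin lerXn2r ?nnegrE.
exists v; first exact: span_simple vE.
rewrite -(@ltr_pXn2r _ p)// ?nnegrE ?(ltW e0)// -lte_fin.
rewrite (Lspace_pow_norm (mB N)); last first.
  apply: filterS3 (LreprB u v) uf vE => x h1 h2 h3 xT.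
  by rewrite h1//= h2// h3.
by rewrite -(fineK Nfin) lte_fin; apply: le_lt_trans Nlt;
  rewrite subr0 ler_norm.
Qed.

Lemma Lspace_countably_spanned : countably_spanned E.
Proof.
exists I, indic_class => u; pose f := Lrepr u : T -> R.
have mf : measurable_fun setT f by [].
have part (h : T -> R) : measurable_fun setT h ->
    (forall x, `|h x| <= `|f x|) ->
    exists v : E, (Lrepr v : T -> R) = h %[ae mu].
  move=> mh hf; apply: Lspace_class => //.
  apply: (@le_lt_trans _ _ (\int[mu]_x (f x ^+ p)%:E)%E).
    apply: ge0_le_integral => //.
    - by move=> x _; rewrite lee_fin pow_even_ge0.
    - exact: measurable_pow_even.
    - exact: measurable_pow_even.
    - move=> x _; rewrite lee_fin -pow_even_norm -(pow_even_norm _ (f x)).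
      by rewrite lerXn2r ?nnegrE.
  by rewrite -Lspace_pow_normE ltry.
pose fp x := Num.max (f x) 0; pose fm x := Num.max (- f x) 0.
have mfp : measurable_fun setT fp by exact: measurable_maxr.
have mfm : measurable_fun setT fm.
  by apply: measurable_maxr => //; exact: measurableT_comp.
have [v vE] : exists v : E, (Lrepr v : T -> R) = fp %[ae mu].
  apply: part => // x; rewrite /fp; case: (leP (f x) 0) => // _.
  by rewrite normr0.
have [w wE] : exists w : E, (Lrepr w : T -> R) = fm %[ae mu].
  apply: part => // x; rewrite /fm; case: (leP (- f x) 0) => // _.
    by rewrite normr0.
  by rewrite normrN.
suff -> : u = v + (-1) *: w.
  apply: rat_spanD.
    by apply: span_ge0 mfp _ vE => x; rewrite /fp le_max lexx orbT.
  by apply: rat_spanZ; apply: span_ge0 mfm _ wE => x;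
    rewrite /fm le_max lexx orbT.
rewrite scaleN1r; apply: (@Lrepr_inj _ _ f); first exact: nearW.
apply: filterS3 (LreprB v w) vE wE => x h1 h2 h3 xT.
by rewrite h1//= h2// h3// pos_sub_neg_part.
Qed.

End Lspace_separable.

(** * Approximation of Borel sets by finite unions of basic open sets *)

(** The countable basis is enumerated by [nat], values that enumerate no basic
    set giving the empty set. *)
Lemma second_countable_seq_basis (T : topologicalType) : @second_countable T ->
  exists b : nat -> set T, (forall i, open (b i)) /\
    forall x U, open U -> U x -> exists2 i, b i x & b i `<=` U.
Proof.
move=> [B /countable_injP[f finj] [Bopen Bbasis]].
have /choice[b bP] : forall i, exists V : set T,
    open V /\ forall W, B W -> f W = i -> W = V.
  move=> i; have [[W [BW fW]]|noW] := pselect (exists W, B W /\ f W = i).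
    exists W; split; first exact: Bopen.
    by move=> W' BW' fW'; apply: finj; rewrite ?inE// fW fW'.
  exists set0; split; first exact: open0.
  by move=> W BW fW; exfalso; apply: noW; exists W.
exists b; split=> [i|x U oU Ux]; first by have [] := bP i.
have [W [BW Wx] WU] := Bbasis x U (open_nbhs_nbhs (conj oU Ux)).
by exists (f W); have [_ /(_ W BW erefl) <-] := bP (f W).
Qed.

Section borel_measure_dense.
Context (R : realType) (T : ptopologicalType).
Variable mu : {measure set (borelType T) -> \bar R}.
Hypothesis outer : forall A : set (borelType T), measurable A ->
  mu A = ereal_inf [set mu U | U in [set U : set T | open U /\ A `<=` U]].
Variable b : nat -> set T.
Hypothesis bopen : forall i, open (b i).
Hypothesis bbasis : forall x U, open U -> U x -> exists2 i, b i x & b i `<=` U.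

Lemma open_borel (U : set T) : open U -> measurable (U : set (borelType T)).
Proof. by move=> oU; exact: sub_sigma_algebra. Qed.

(** Unions of infinite measure are replaced by the empty set, so that each
    member of the family has an indicator in the Lebesgue space. *)
Definition basic_union (l : seq nat) : set (borelType T) :=
  if (mu (\bigcup_(i in [set` l]) b i) < +oo)%E
  then \bigcup_(i in [set` l]) b i else set0.

Lemma measure_setD_lt (A B : set (borelType T)) (e : R) :
  measurable A -> measurable B -> A `<=` B -> (mu A < +oo)%E ->
  (mu B < mu A + e%:E)%E -> (mu (B `\` A) < e%:E)%E.
Proof.
move=> mA mB AB fA; rewrite (measureDI mu mB mA) setIC (setIidl AB) addeC.
by rewrite lteD2lE// ge0_fin_numE.
Qed.

(** By outer regularity the set is almost filled by an open superset, which is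
    an increasing union of finite unions of basic sets. *)
Lemma basic_union_dense : measure_dense mu basic_union.
Proof.
have ml (l : seq nat) :
    measurable (\bigcup_(i in [set` l]) b i : set (borelType T)).
  by apply: open_borel; apply: bigcup_open => i _; exact: bopen.
split=> [l|A mA fA e e0].
  rewrite /basic_union; case: ifPn => [lfin|_]; first by split.
  by rewrite measure0; split=> //; exact: measurable0.
have e2 : 0 < e / 2 by rewrite divr_gt0.
have Afin : mu A \is a fin_num by rewrite ge0_fin_numE.
have [_ [U [oU AU] <-] UA] : exists2 z,
    [set mu U | U in [set U : set T | open U /\ A `<=` U]] z &
    (z < mu A + (e / 2)%:E)%E.
  by apply: ereal_inf_lt; rewrite -outer// lteDl ?lte_fin.
have mU := open_borel oU.
have fU : (mu U < +oo)%E.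
  by apply: (lt_le_trans UA); rewrite leey.
(* [V N] is the union of those among the first [N] basic sets that lie in
   [U]. *)
pose l N := [seq i <- iota 0 N | `[< b i `<=` U >]].
pose V N : set (borelType T) := \bigcup_(i in [set` l N]) b i.
have VU N : V N `<=` U.
  by apply: bigcup_sub => i /=; rewrite mem_filter => /andP[/asboolP].
have bigV : \bigcup_N V N = U.
  apply/seteqP; split; first by apply: bigcup_sub => N _; exact: VU.
  move=> x Ux; have [i bix biU] := bbasis oU Ux.
  exists i.+1 => //; exists i => //=.
  by rewrite mem_filter mem_iota/= add0n leqnn andbT; exact/asboolP.
have ndV : nondecreasing_seq V.
  move=> M N MN; apply/subsetPset; apply: bigcup_subset => i /=.
  rewrite !mem_filter => /andP[-> /=]; rewrite !mem_iota /= !add0n => iM.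
  exact: leq_trans MN.
have := @nondecreasing_cvg_mu _ _ _ mu V (fun N => ml (l N)) _ ndV.
rewrite bigV => /(_ mU) Vcvg.
have Ufin : mu U \is a fin_num by rewrite ge0_fin_numE.
have [N UN] : exists N, (mu U < mu (V N) + (e / 2)%:E)%E.
  apply/not_existsP => h.
  have : (mu U <= mu U - (e / 2)%:E)%E.
    rewrite -{1}(cvg_lim _ Vcvg)//; apply: lime_le; first exact: cvgP Vcvg.
    apply: nearW => N; rewrite leeBrDr//.
    by rewrite leNgt; apply/negP; exact: h.
  by rewrite leNgt lteBlDr// lteDl// lte_fin e2.
exists (l N).
have fV : (mu (V N) < +oo)%E.
  by apply: le_lt_trans fU; apply: le_measure; rewrite ?inE//; exact: ml.
rewrite /basic_union fV -/(V N).
have h1 : (mu (A `\` V N) < (e / 2)%:E)%E.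
  apply: le_lt_trans (measure_setD_lt (ml _) mU (VU N) fV UN).
  apply: le_measure; rewrite ?inE; try by apply: measurableD => //; exact: ml.
  exact: setSD.
have h2 : (mu (V N `\` A) < (e / 2)%:E)%E.
  apply: le_lt_trans (measure_setD_lt mA mU AU fA UA).
  apply: le_measure; rewrite ?inE; try by apply: measurableD => //; exact: ml.
  exact: setSD.
by rewrite [e]splitr EFinD lteD.
Qed.

End borel_measure_dense.

(** * Balls of a plig metric and their Haar volume *)

Section plig_volume.
Context (R : realType) (G : topologicalGroupType) (d : G -> G -> R).
Variable mu : {measure set (borelType G) -> \bar R}.
Hypotheses (pd : plig_metric d) (haar : left_haar_measure mu).

Definition dball (x : G) (r : R) : set (borelType G) := [set z | d x z < r].

Lemma plig_ge0 x y : 0 <= d x y. Proof. by case: pd => -[]. Qed.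
Lemma plig_sym x y : d x y = d y x. Proof. by case: pd => -[]. Qed.
Lemma plig_triangle x y z : d x z <= d x y + d y z.
Proof. by case: pd => -[]. Qed.
Lemma plig_invariant g x y : d (g * x)%g (g * y)%g = d x y.
Proof. by case: pd. Qed.

Lemma plig_open (U : set G) :
  (forall z, U z -> exists2 e, 0 < e & [set y | d z y < e] `<=` U) -> open U.
Proof.
move=> h; rewrite openE => z Uz; have [_ _ _ gen] := pd.
by apply/gen; exact: h.
Qed.

Lemma dball_open x r : open (dball x r : set G).
Proof.
apply: plig_open => z /= xz; exists (r - d x z); first by rewrite subr_gt0.
by move=> y /=; rewrite ltrBrDl; apply: le_lt_trans; exact: plig_triangle.
Qed.

Lemma dball_measurable x r : measurable (dball x r).
Proof. by apply: open_borel; exact: dball_open. Qed.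

Lemma measurable_plig x : measurable_fun setT (d x : borelType G -> R).
Proof.
apply: (measurability _ (RGenInftyO.measurableE R)) => //.
move=> _ [_ [r ->] <-]; rewrite setTI.
suff -> : d x @^-1` `]-oo, r[ = dball x r by exact: dball_measurable.
by apply/seteqP; split=> z; rewrite /= in_itv.
Qed.

(** Closed balls are compact by properness, and the measure is finite on compact
    sets. *)
Lemma dball_fin x r : (mu (dball x r) < +oo)%E.
Proof.
pose K : set (borelType G) := [set z | d x z <= r].
have oK : open (~` (K : set G)).
  apply: plig_open => z /negP; rewrite -ltNge => xz.
  exists (d x z - r); first by rewrite subr_gt0.
  move=> y /=; rewrite ltrBrDl => h; apply/negP; rewrite -ltNge.
  by have := plig_triangle x y z; rewrite (plig_sym y z); lra.
have cK : compact (K : set G).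
  have [_ proper _ _] := pd; apply: proper.
    by rewrite -(setCK (K : set G)); exact: open_closedC.
  exists (r + r) => y z yK zK; apply: le_trans (plig_triangle y x z) _.
  by rewrite (plig_sym y x) lerD.
have mK : measurable K.
  by rewrite -(setCK K); apply: measurableC; exact: open_borel.
have [[+ _ _] _ _] := haar => /(_ _ cK mK); apply: le_lt_trans.
by apply: le_measure; rewrite ?inE//; [exact: dball_measurable|move=> z /ltW].
Qed.

(** The volume of a ball depends on its radius only, by left invariance of both
    the metric and the measure: see [mu_dball]. *)
Definition vol r : R := fine (mu (dball 1%g r)).

Lemma vol_ge0 r : 0 <= vol r. Proof. exact: fine_ge0. Qed.

Lemma mu_dball x r : mu (dball x r) = (vol r)%:E.
Proof.
have [_ _ inv] := haar.
rewrite fineK; last by rewrite ge0_fin_numE// dball_fin.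
rewrite -(inv x _ (dball_measurable 1%g r)); congr (mu _).
apply/seteqP; split=> [z xz|_ [z /= z1 <-]].
  exists (x^-1 * z)%g; last by rewrite mulgA mulgV mul1g.
  by rewrite /dball/= -(plig_invariant x) mulg1 mulgA mulgV mul1g.
by rewrite /dball/= -[X in d X _](mulg1 x) plig_invariant.
Qed.

(** The group, which is not a null set, is the increasing union of the balls
    around [1]. *)
Lemma vol_gt0 : exists2 c, 1 <= c & 0 < vol c.
Proof.
apply: contrapT => h.
have vol0 (k : nat) : mu (dball 1%g k.+1%:R) = 0%E.
  rewrite mu_dball; congr (_%:E); apply/eqP; rewrite eq_le vol_ge0 andbT leNgt.
  by apply/negP => k0; apply: h; exists k.+1%:R; rewrite ?ler1n.
have [_ /eqP muT _] := haar; apply: muT.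
have bigT : \bigcup_k dball 1%g k.+1%:R = setT.
  apply/seteqP; split=> // z _; exists (Num.truncn (d 1%g z)) => //.
  exact: truncnS_gt.
have nd : nondecreasing_seq (fun k : nat => dball 1%g k.+1%:R).
  move=> k l kl; apply/subsetPset => z /= z1; apply: lt_le_trans z1 _.
  by rewrite ler_nat.
have := @nondecreasing_cvg_mu _ _ _ mu _ (fun k =>
  dball_measurable 1%g k.+1%:R) _ nd.
rewrite bigT => /(_ measurableT) => c.
suff cst0 : mu \o (fun k : nat => dball 1%g k.+1%:R) = cst 0%E.
  by rewrite -(cvg_lim _ c)// cst0; exact: lim_cst.
by apply/funext => k; exact: vol0.
Qed.

End plig_volume.

(** * Tent functions *)

Section tents.
Context (R : realType) (G : topologicalGroupType) (d : G -> G -> R).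
Variable mu : {measure set (borelType G) -> \bar R}.
Hypotheses (pd : plig_metric d) (haar : left_haar_measure mu).
Variables (r : R) (r0 : 0 < r).
Implicit Types x y z : G.

Definition tent x z : R := Num.max 0 (1 - d x z / r).

Lemma tent_ge0 x z : 0 <= tent x z.
Proof. by rewrite le_max lexx. Qed.

Lemma tent_le1 x z : tent x z <= 1.
Proof. by rewrite ge_max ler01 gerBl divr_ge0 ?(plig_ge0 pd)// ltW. Qed.

Lemma tent_out x z : r <= d x z -> tent x z = 0.
Proof. by move=> xz; apply/max_idPl; rewrite subr_le0 ler_pdivlMr// mul1r. Qed.

Lemma tent_in x z : d x z <= r / 2 -> 2^-1 <= tent x z.
Proof.
move=> xz; rewrite le_max; apply/orP; right.
have : d x z / r <= 2^-1 by rewrite ler_pdivrMr// mulrC.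
lra.
Qed.

Lemma tent_lip x y z : `|tent x z - tent y z| <= d x y / r.
Proof.
wlog xy : x y / tent y z <= tent x z.
  move=> h; have [/h//|/ltW/h] := leP (tent y z) (tent x z).
  by rewrite distrC (plig_sym pd).
rewrite ger0_norm ?subr_ge0// lerBlDr [leLHS]/tent ge_max; apply/andP; split.
  by rewrite addr_ge0 ?tent_ge0// divr_ge0 ?(plig_ge0 pd)// ltW.
have h : 1 - d y z / r <= tent y z by rewrite le_max lexx orbT.
have : d y z / r <= d x y / r + d x z / r.
  rewrite -mulrDl ler_pM2r ?invr_gt0// (plig_sym pd x y).
  exact: (plig_triangle pd).
lra.
Qed.

Lemma measurable_tent x : measurable_fun setT (tent x : borelType G -> R).
Proof.
apply: measurable_maxr; first exact: measurable_cst.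
apply: measurable_funB; first exact: measurable_cst.
by apply: measurable_funM; [exact: (measurable_plig pd)|exact: measurable_cst].
Qed.

Variable n : nat.
Local Notation p := (2 * n.+1)%N.
Local Notation E := (LspaceType mu (exponent_ge1 R n)).

Lemma tent_class_subproof x :
  exists u : E, (Lrepr u : borelType G -> R) = tent x %[ae mu].
Proof.
apply: Lspace_class; first exact: measurable_tent.
apply: (@le_lt_trans _ _ (mu (dball d x r))); last exact: dball_fin pd haar _ _.
have mb := dball_measurable pd x r.
have <- := @integral_pow_indic _ _ _ mu n _ mb.
apply: ge0_le_integral.
- exact: measurableT.
- by move=> z _; rewrite lee_fin pow_even_ge0.
- exact: measurable_pow_even (measurable_tent x).
- by apply: measurable_pow_even; exact: measurable_indic.
- move=> z _; rewrite lee_fin lerXn2r ?nnegrE ?tent_ge0// indicE.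
  have [_|] := boolP (_ \in _); first exact: tent_le1.
  by rewrite notin_setE /dball/= => /negP; rewrite -leNgt => /tent_out ->.
Qed.

Definition tent_class x : E := projT1 (cid (tent_class_subproof x)).

Lemma tent_classE x :
  (Lrepr (tent_class x) : borelType G -> R) = tent x %[ae mu].
Proof. exact: projT2 (cid (tent_class_subproof x)). Qed.

Lemma tent_class_dist x y : ((`|tent_class x - tent_class y| ^+ p)%:E =
  \int[mu]_z ((tent x z - tent y z) ^+ p)%:E)%E.
Proof.
apply: (@Lspace_pow_norm _ (borelType G) _ mu n _ (fun z =>
  tent x z - tent y z)).
  by apply: measurable_funB; exact: measurable_tent.
apply: filterS3 (LreprB (tent_class x) (tent_class y)) (tent_classE x)
  (tent_classE y) => z h1 h2 h3 zT.
by rewrite h1//= h2// h3.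
Qed.

(** The difference of two tents is at most [d x y / r] and vanishes outside two
    balls of radius [r]. When the exponent is large with respect to [r], the
    total volume of these balls contributes a factor at most 2 to the norm. *)
Lemma tent_class_lip x y : 2 * vol d mu r <= 2 ^+ p ->
  `|tent_class x - tent_class y| <= 2 * (d x y / r).
Proof.
move=> volr.
have dr0 : 0 <= d x y / r by rewrite divr_ge0 ?(plig_ge0 pd)// ltW.
have dr2 : 0 <= 2 * (d x y / r) by exact: mulr_ge0.
rewrite -(@ler_pXn2r _ p)// ?nnegrE// -lee_fin tent_class_dist.
have mi w : measurable_fun setT (fun z : borelType G =>
  (\1_(dball d w r) z : R)%:E).
  apply/measurable_EFinP; apply: measurable_indic; exact: (dball_measurable pd).
apply: (@le_trans _ _ (((d x y / r) ^+ p)%:E *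
    \int[mu]_z ((\1_(dball d x r) z)%:E + (\1_(dball d y r) z)%:E))%E);
  last first.
  rewrite ge0_integralD//.
  rewrite !integral_indic//; try exact: (dball_measurable pd).
  rewrite !setIT !(mu_dball pd haar) -EFinD -EFinM lee_fin [leRHS]exprMn.
  rewrite mulrC ler_wpM2r ?exprn_ge0//.
  by move: volr; rewrite (mulr_natl (vol d mu r) 2) mulr2n.
rewrite -ge0_integralZl_EFin; last 4 first.
- exact: measurableT.
- by move=> z _; rewrite adde_ge0// lee_fin.
- by apply: emeasurable_funD; exact: mi.
- exact: exprn_ge0.
apply: ge0_le_integral.
- exact: measurableT.
- by move=> z _; rewrite lee_fin pow_even_ge0.
- apply: measurable_pow_even; apply: measurable_funB; exact: measurable_tent.
- by apply: measurable_funeM; apply: emeasurable_funD; exact: mi.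
- move=> z _; rewrite -EFinD -EFinM lee_fin.
  have [zx|zx] := boolP ((z \in dball d x r) || (z \in dball d y r)).
    rewrite -pow_even_norm (@le_trans _ _ ((d x y / r) ^+ p))//.
      by rewrite lerXn2r ?nnegrE// tent_lip.
    rewrite ler_peMr ?exprn_ge0// !indicE.
    by case/orP: zx => ->; rewrite ?lerDl ?lerDr.
  move: zx; rewrite negb_or => /andP[]; rewrite !notin_setE /dball/=.
  move=> /negP; rewrite -leNgt => /tent_out -> /negP;
    rewrite -leNgt => /tent_out ->.
  by rewrite subrr expr0n/= mulr_ge0 ?exprn_ge0// addr_ge0.
Qed.

(** The second tent vanishes on the ball of radius [c] around [x], where the
    first one is at least [2^-1]. When the exponent is large with respect to
    [c], the volume of this ball costs a factor at most 2. *)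
Lemma tent_class_far (c : R) x y : c <= r / 2 -> 1 <= 2 ^+ p * vol d mu c ->
  2 * r <= d x y -> 4^-1 <= `|tent_class x - tent_class y|.
Proof.
move=> cr volc xy.
have arith (a b e : R) : a < c -> 2 * r <= e -> e <= a + b -> r <= b.
  have rpos := r0; clear volc => h1 h2 h3; lra.
have mb := dball_measurable pd x c.
rewrite -(@ler_pXn2r _ p)// ?nnegrE// -lee_fin tent_class_dist.
apply: (@le_trans _ _ ((2^-1 ^+ p)%:E * mu (dball d x c))%E).
  rewrite (mu_dball pd haar) -EFinM lee_fin.
  have -> : 4^-1 ^+ p = 2^-1 ^+ p * 2^-1 ^+ p :> R.
    by rewrite -exprMn; congr (_ ^+ p); rewrite -invfM -natrM.
  rewrite ler_pM2l ?exprn_gt0//.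
  by rewrite exprVn -[leLHS]mulr1 ler_pdivrMl// exprn_gt0.
have := @integral_indic _ _ _ mu _ measurableT _ mb; rewrite setIT => <-.
rewrite -ge0_integralZl_EFin; last 4 first.
- exact: measurableT.
- by move=> z _; rewrite lee_fin.
- by apply/measurable_EFinP; exact: measurable_indic.
- by rewrite exprn_ge0.
apply: ge0_le_integral.
- exact: measurableT.
- by move=> z _; rewrite -EFinM lee_fin mulr_ge0// exprn_ge0.
- by apply: measurable_funeM; apply/measurable_EFinP; exact: measurable_indic.
- apply: measurable_pow_even; apply: measurable_funB; exact: measurable_tent.
- move=> z _; rewrite -EFinM lee_fin indicE.
  have [|_] := boolP (_ \in _); last by rewrite mulr0 pow_even_ge0.
  rewrite inE /dball/= mulr1 => xz.
  have -> : tent y z = 0.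
    apply: tent_out; have := plig_triangle pd x z y; rewrite (plig_sym pd z y).
    exact: arith xz xy.
  rewrite subr0 lerXn2r ?nnegrE ?tent_ge0// tent_in//.
  exact: le_trans (ltW xz) cr.
Qed.

End tents.

(** * The embedding *)

(** By induction with the stronger bound [2 - N^-1] for [N] positive, because
    [(N + 1) ^- 2 <= N^-1 - (N + 1)^-1]. *)
Lemma sum_inv_sqr_le2 (R : realFieldType) N :
  \sum_(0 <= k < N) (k.+1%:R ^- 2 : R) <= 2.
Proof.
suff h : \sum_(0 <= k < N.+1) (k.+1%:R ^- 2 : R) <= 2 - N.+1%:R^-1.
  apply: (@le_trans _ _ (2 - N.+1%:R^-1)); last by rewrite gerBl invr_ge0.
  apply: le_trans h; rewrite big_nat_recr//= lerDl invr_ge0 exprn_ge0//.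
elim: N => [|N IH]; first by rewrite big_nat1 expr1n invr1; lra.
rewrite big_nat_recr//=; apply: (le_trans (lerD IH (lexx _))).
have N0 : 0 < N.+1%:R :> R by rewrite ltr0n.
rewrite -addn1 natrD -[N.+2]addn1 natrD; move: (N.+1%:R : R) N0 => a a0.
have -> : 2 - a^-1 + (a + 1) ^- 2 = 2 - (a + 1)^-1 - (a * (a + 1) ^+ 2)^-1.
  by field; rewrite !gt_eqF// addr_gt0.
by rewrite gerBl invr_ge0 mulr_ge0 ?ltW// exprn_gt0// addr_gt0.
Qed.

Section sparse_sums.
Context (R : realDomainType) (N : nat -> nat) (F : nat -> R).
Hypothesis N_lt : forall k, (N k < N k.+1)%N.

Lemma sparse_mono : {mono N : m n / (m <= n)%N}.
Proof. by apply: leq_mono; apply: homo_ltn => // x y z; exact: ltn_trans. Qed.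

Lemma sparse_ge_id k : (k <= N k)%N.
Proof. by elim: k => // k IH; exact: leq_ltn_trans IH (N_lt k). Qed.

(** Between [N J] and [N J.+1] only the term of index [N J] is kept. *)
Lemma sparse_sum_ge J : (forall n, 0 <= F n) ->
  \sum_(0 <= k < J) F (N k) <= \sum_(0 <= n < N J) F n.
Proof.
move=> F0; elim: J => [|J IH]; first by rewrite big_geq// sumr_ge0.
rewrite big_nat_recr//= [leRHS](@big_cat_nat _ _ _ (N J))//=;
  last exact: ltnW (N_lt _).
rewrite (big_ltn (N_lt J)) lerD// lerDl.
by rewrite sumr_ge0.
Qed.

Lemma sparse_sum_le M : (forall n, 0 <= F n) ->
  (forall n, (forall k, N k != n) -> F n = 0) ->
  \sum_(0 <= n < M) F n <= \sum_(0 <= k < M) F (N k).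
Proof.
move=> F0 Fout; apply: (@le_trans _ _ (\sum_(0 <= n < N M) F n)).
  rewrite [leRHS](@big_cat_nat _ _ _ M)//= ?sparse_ge_id//.
  by rewrite lerDl sumr_ge0.
elim: M => [|M IH].
  rewrite [leRHS]big_geq// big_nat big1// => n /andP[_ n0]; apply: Fout => k.
  by rewrite gtn_eqF// (leq_trans n0)// sparse_mono.
rewrite [leRHS]big_nat_recr//= (@big_cat_nat _ _ _ (N M))//=;
  last exact: ltnW (N_lt _).
rewrite (big_ltn (N_lt M)) lerD// -[leRHS]addr0 lerD2l.
rewrite big_nat big1// => n /andP[Mn nM]; apply: Fout => k.
have [kM|Mk] := leqP k M.
  by rewrite ltn_eqF// (leq_ltn_trans _ Mn)// sparse_mono.
by rewrite gtn_eqF// (leq_trans nM)// sparse_mono.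
Qed.

End sparse_sums.

Section embedding.
Context (R : realType) (G : topologicalGroupType) (d : G -> G -> R).
Variable mu : {measure set (borelType G) -> \bar R}.
Hypotheses (pd : plig_metric d) (haar : left_haar_measure mu).
Variables (c : R) (c1 : 1 <= c) (volc : 0 < vol d mu c).
Implicit Types x y : G.

Definition radius k : R := 2 * c * k.+1%:R.

Lemma radius_gt0 k : 0 < radius k.
Proof. by rewrite !mulr_gt0// (lt_le_trans ltr01). Qed.

(** The two conditions say that the p-th roots of the volumes that occur in
    [tent_class_lip] and [tent_class_far] are at most 2 and at least 1/2. *)
Definition good_exponent k n := 2 * vol d mu (radius k) <= 2 ^+ (2 * n.+1) /\
  1 <= 2 ^+ (2 * n.+1) * vol d mu c.

Lemma good_exponent_large k :
  exists m, forall n, (m <= n)%N -> good_exponent k n.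
Proof.
(* [2 ^ p] exceeds any constant when [p] is large. *)
pose M := Num.max (2 * vol d mu (radius k)) (vol d mu c)^-1.
have large n : (Num.truncn M <= n)%N -> M <= 2 ^+ (2 * n.+1).
  move=> Mn; apply: (@le_trans _ _ n.+1%:R).
    by apply: (le_trans (ltW (truncnS_gt _))); rewrite ler_nat.
  rewrite -natrX ler_nat; apply: leq_trans (ltnW (ltn_expl _ (ltnSn 1))) _.
  by rewrite leq_exp2l// leq_pmull.
exists (Num.truncn M) => n /large; rewrite /good_exponent ge_max => /andP[-> h].
by split=> //; rewrite -ler_pdivrMr// mul1r.
Qed.

(** The exponents have to be distinct for different radii, because each summand
    hosts the tents of one radius; they are taken increasing. *)
Lemma exponents_exist : exists N : nat -> nat,
  (forall k, (N k < N k.+1)%N) /\ forall k, good_exponent k (N k).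
Proof.
have /choice[m mP] := good_exponent_large.
(* The summand [k] makes the partial sums strictly increasing. *)
exists (fun k => k + \sum_(0 <= j < k.+1) m j)%N; split=> k.
  by rewrite [in ltnRHS]big_nat_recr//= addSn ltnS leq_add2l leq_addr.
by apply: mP; rewrite big_nat_recr//= addnA leq_addl.
Qed.

Variable N : nat -> nat.
Hypotheses (N_lt : forall k, (N k < N k.+1)%N)
           (N_good : forall k, good_exponent k (N k)).
Local Notation E n := (LspaceType mu (exponent_ge1 R n)).

Definition tent_at k n x : E n := tent_class pd haar (radius_gt0 k) n x.

(** The coordinate [N k] hosts the tents of radius [radius k], all the others
    are zero: the sum has at most one term, and its range loses no term because
    [k <= N k]. Subtracting the tent at [1] makes the sequence square summable,
    without changing differences. *)
Definition tent_seq x : seq_prod (fun n => E n) :=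
  fun n => \sum_(k < n.+1 | N k == n) (tent_at k n x - tent_at k n 1%g).

Lemma tent_seqB_on x y k :
  (tent_seq x - tent_seq y) (N k) = tent_at k (N k) x - tent_at k (N k) y.
Proof.
have kN : (k < (N k).+1)%N by rewrite ltnS sparse_ge_id.
have one z : tent_seq z (N k) = tent_at k (N k) z - tent_at k (N k) 1%g.
  rewrite /tent_seq (big_pred1 (Ordinal kN))// => j.
  by rewrite /= -(inj_eq val_inj)/= (inj_eq (incn_inj (sparse_mono N_lt))).
rewrite -[LHS]/(tent_seq x (N k) - tent_seq y (N k)) !one.
by rewrite opprB addrA subrK.
Qed.

Lemma tent_seqB_off x y n :
  (forall k, N k != n) -> (tent_seq x - tent_seq y) n = 0.
Proof.
move=> nN; rewrite -[LHS]/(tent_seq x n - tent_seq y n) /tent_seq.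
by rewrite !big_pred0 ?subrr// => k; exact/negbTE.
Qed.

(** Tents of radius [radius k] contribute [(d x y / (c * k.+1)) ^+ 2], a
    convergent series. *)
Lemma tent_seq_lip x y M :
  \sum_(0 <= n < M) `|(tent_seq x - tent_seq y) n| ^+ 2 <= (2 * d x y) ^+ 2.
Proof.
have c0 : 0 < c by exact: lt_le_trans c1.
pose F n : R := `|(tent_seq x - tent_seq y) n| ^+ 2.
have F0 n : 0 <= F n by exact: sqr_ge0.
have Foff n : (forall k, N k != n) -> F n = 0.
  by move=> nN; rewrite /F tent_seqB_off// normr0 expr0n.
apply: le_trans (sparse_sum_le N_lt M F0 Foff) _; rewrite /F.
apply: (@le_trans _ _ (\sum_(0 <= k < M) (d x y / c) ^+ 2 * k.+1%:R ^- 2)).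
  apply: ler_sum => k _; rewrite tent_seqB_on.
  rewrite -exprVn -exprMn lerXn2r ?nnegrE//.
    by rewrite mulr_ge0 ?divr_ge0 ?invr_ge0// ?(plig_ge0 pd)// ltW.
  have [h _] := N_good k.
  apply: le_trans (tent_class_lip pd haar (radius_gt0 k) x y h) _.
  rewrite /radius le_eqVlt; apply/orP; left; apply/eqP; field.
  by rewrite nat1r pnatr_eq0/= gt_eqF.
rewrite -mulr_sumr.
apply: (le_trans (ler_wpM2l _ (sum_inv_sqr_le2 R M))); first exact: sqr_ge0.
rewrite !exprMn.
have : d x y ^+ 2 * c^-1 ^+ 2 <= d x y ^+ 2.
  have ci0 : 0 <= c^-1 by rewrite invr_ge0 ltW.
  have ci1 : c^-1 <= 1 by rewrite invf_le1.
  by rewrite ler_piMr ?sqr_ge0// exprn_ile1.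
have := sqr_ge0 (d x y); rewrite expr2; lra.
Qed.

Lemma tent_seq1 : tent_seq 1%g = 0.
Proof.
apply: functional_extensionality_dep => n; rewrite /tent_seq.
by rewrite big1// => k _; rewrite subrr.
Qed.

Lemma tent_seq_bound x M :
  \sum_(0 <= n < M) `|tent_seq x n| ^+ 2 <= (2 * d x 1%g) ^+ 2.
Proof. by have := tent_seq_lip x 1%g M; rewrite tent_seq1 subr0. Qed.

Definition embedding x : sum_L2n mu := l2sum_of (tent_seq_bound x).

Lemma embedding_lip x y : `|embedding x - embedding y| <= 2 * d x y.
Proof.
apply: l2sum_norm_le; first by rewrite mulr_ge0// (plig_ge0 pd).
move=> M; under eq_bigr do rewrite l2sum_coordB.
exact: tent_seq_lip.
Qed.

(** Each of the [J] smallest radii contributes at least [4^-1 ^+ 2], the two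
    points being at distance at least twice that radius. *)
Lemma embedding_far x y J : 4 * c * J%:R <= d x y ->
  J%:R * 4^-1 ^+ 2 <= `|embedding x - embedding y| ^+ 2.
Proof.
move=> Jd; apply: le_trans (l2sum_partial_norm _ (N J)).
pose F n : R := `|(tent_seq x - tent_seq y) n| ^+ 2.
rewrite (eq_bigr F) => [|n _]; last by rewrite l2sum_coordB.
have F0 n : 0 <= F n by exact: sqr_ge0.
apply: le_trans (sparse_sum_ge N_lt J F0); rewrite /F.
rewrite mulr_natl -[in leLHS](subn0 J) -sumr_const_nat.
rewrite big_nat [leRHS]big_nat; apply: ler_sum => k /andP[_ kJ].
rewrite tent_seqB_on lerXn2r ?nnegrE//.
have [_ h] := N_good k.
have c0 : 0 < c by exact: lt_le_trans c1.
apply: (tent_class_far pd haar (radius_gt0 k) _ h).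
  rewrite /radius; have : 1 <= k.+1%:R :> R by rewrite ler1n.
  by move=> /(ler_wpM2l (ltW c0)); rewrite mulr1; lra.
apply: le_trans Jd.
have -> : 2 * radius k = 4 * c * k.+1%:R by rewrite /radius; field.
by rewrite ler_pM2l ?mulr_gt0// ler_nat.
Qed.

(** The number of radii at most [d x y / 2] grows linearly with [d x y], whence
    a lower control function of the order of a square root. *)
Lemma embedding_uniform :
  uniform_embedding d (@norm_dist R (sum_L2n mu)) embedding.
Proof.
have c0 : 0 < c by exact: lt_le_trans c1.
have c40 : 0 < 4 * c by exact: mulr_gt0.
(* [Num.sqrt] vanishes on negative numbers, so no truncation is needed. *)
exists (fun t => Num.sqrt (t / (4 * c) - 1) / 4), (fun t => 2 * t); split.
- split.
  + by move=> t _; rewrite divr_ge0// sqrtr_ge0.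
  + move=> s t _ st; rewrite ler_pM2r ?invr_gt0// ler_wsqrtr// lerB//.
    by rewrite ler_pM2r ?invr_gt0.
  + apply/cvgryPge => A; exists (((4 * `|A|) ^+ 2 + 1) * (4 * c)).
    split; first exact: num_real.
    move=> t At; rewrite ler_pdivlMr// mulrC.
    apply: (@le_trans _ _ (4 * `|A|)); first by rewrite ler_pM2l// ler_norm.
    rewrite -[leLHS]ger0_norm ?mulr_ge0// -sqrtr_sqr ler_wsqrtr//.
    by rewrite lerBrDr ler_pdivlMr// ltW.
- split.
  + by move=> t t0; rewrite mulr_ge0.
  + by move=> s t _ st; rewrite ler_pM2l.
  + apply/cvgryPge => A; exists `|A|; split; first exact: num_real.
    move=> t At; have := ler_norm A; have := normr_ge0 A; lra.
move=> x y; apply/andP; split; last exact: embedding_lip.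
pose J := Num.truncn (d x y / (4 * c)).
have dc0 : 0 <= d x y / (4 * c) by rewrite divr_ge0 ?(plig_ge0 pd)// ltW.
have Jd : 4 * c * J%:R <= d x y.
  by rewrite mulrC -ler_pdivlMr// truncn_le.
have dJ : d x y / (4 * c) - 1 <= J%:R.
  by rewrite lerBlDr natr1 ltW// truncnS_gt.
rewrite /norm_dist.
have h := embedding_far Jd.
rewrite -[leRHS]ger0_norm// -sqrtr_sqr.
apply: le_trans (ler_wsqrtr h).
rewrite sqrtrM// sqrtr_sqr ger0_norm// ler_pM2r// ler_wsqrtr//.
Qed.

End embedding.

Theorem corollary6p6 (R : realType) (G : topologicalGroupType)
    (d : G -> G -> R) (mu : {measure set (borelType G) -> \bar R}) :
  hausdorff_space G -> locally_compact [set: G] -> @second_countable G ->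
  plig_metric d -> left_haar_measure mu ->
  [/\ banach (sum_L2n mu), separable_space (sum_L2n mu),
      strictly_convex (sum_L2n mu)
    & exists f : G -> sum_L2n mu,
        uniform_embedding d (@norm_dist R (sum_L2n mu)) f].
Proof.
move=> _ _ G2 pd haar; split.
- apply: geometric_complete_banach; apply: l2sum_complete => n.
  exact: Lspace_complete.
- have [b [bopen bbasis]] := second_countable_seq_basis G2.
  have [[_ outer _] _ _] := haar.
  have dense_b := basic_union_dense outer bopen bbasis.
  have [I [c spanc]] := l2sum_countably_spanned
    (fun n => Lspace_countably_spanned n dense_b).
  exact: rat_span_separable spanc.
- by apply: l2sum_strictly_convex => n; exact: Lspace_strict_midpoint.
- have [c c1 volc] := vol_gt0 pd haar.
  have [N [N_lt N_good]] := exponents_exist volc.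
  exists (embedding pd haar c1 N_lt N_good).
  exact: embedding_uniform.
Qed.
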